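(* Let $j\in\{0,\tfrac12\}$ and $m\in j+\mathbb Z$. Up to scalar multiples, the Goldstone vectors are the only singular vectors for the Virasoro algebra in $\mathcal K_m=\{\xi\in\mathcal H_j: H(0)\xi=m\xi\}$.
   Context: For a non-negative half-integer $i$ (i.e. $i\in\{0,\tfrac12,1,\dots\}$), $V_i$ is the irreducible representation of $\mathfrak{sl}_2$ of dimension $2i+1$. Let $\mathfrak{sl}_2$ be the trace-zero complex $2\times2$ matrices with basis $H=\frac12(E_{11}-E_{22})$, $E=E_{12}$, $F=E_{21}$. A level one unitary positive energy representation of affine $\mathfrak{sl}_2$ is an inner product space $\mathcal H=\bigoplus_{n\ge0}\mathcal H(n)$ (algebraic orthogonal direct sum of finite-dimensional spaces) with operators $X(n)$ ($X\in\mathfrak{sl}_2$, $n\in\mathbb Z$, linear in $X$) and $D$, where $D$ acts as $n$ on $\mathcal H(n)$, $D^*=D$, $X(n)^*=X^*(-n)$, $[D,X(n)]=-nX(n)$ and $[X(m),Y(n)]=[X,Y](m+n)+m\delta_{m+n,0}\mathrm{Tr}(XY)I$. For $j=0,\frac12$, $\mathcal H_j$ denotes the unique irreducible such representation with $\mathcal H_j(0)\cong V_j$ under $X\mapsto X(0)$. The Virasoro algebra acts on $\mathcal H_j$ with central charge $1$ by $$L_0=H(0)^2+2\sum_{n>0}H(-n)H(n),\qquad L_n=\sum_{p+q=n}H(p)H(q)\quad(n\neq0);$$ these operators commute with $\mathfrak{sl}_2$ (acting by $X(0)$) and so preserve each $\mathcal K_m$. A singular vector is a non-zero eigenvector $\xi$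 of $L_0$ with $L_n\xi=0$ for all $n>0$. For each $k\in j+\mathbb Z$ there is, up to a scalar, a unique non-zero vector $\xi_k\in\mathcal H_j$ with $H(0)\xi_k=k\xi_k$ and $H(n)\xi_k=0$ for all $n>0$; it satisfies $L_0\xi_k=k^2\xi_k$. The Goldstone vectors in $\mathcal K_m$ are the (non-zero, singular) vectors $F(0)^{k-m}\xi_k$ with $k\in |m|+\mathbb Z_{\ge0}$; the vector $F(0)^{k-m}\xi_k$ has $L_0$-eigenvalue $k^2$ and (up to a scalar) equals $E(0)^{k+m}\xi_{-k}$. *)

(* Defs.v *)
From HB Require Import structures.
From mathcomp Require Import all_boot all_order all_algebra.
From mathcomp Require Import all_classical all_reals.
From mathcomp Require Import complex.

Set Implicit Arguments.
Unset Strict Implicit.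
Unset Printing Implicit Defensive.

Import Order.TTheory GRing.Theory Num.Theory.
Local Open Scope classical_set_scope.
Local Open Scope ring_scope.
Local Open Scope complex_scope.

(* The complex numbers are R[i] for a realType R.  The Lie algebra sl_2 is the
   space of X : 'M[R[i]]_2 with \tr X = 0; functions of X are total on 2 x 2
   matrices, and only their values at trace-zero X are ever used. *)
Section Sl2.
Variable R : realType.

Definition sl2H : 'M[R[i]]_2 := 2^-1 *: (delta_mx 0 0 - delta_mx 1 1).
Definition sl2E : 'M[R[i]]_2 := delta_mx 0 1.
Definition sl2F : 'M[R[i]]_2 := delta_mx 1 0.

Definition lie_bracket (n : nat) (X Y : 'M[R[i]]_n) : 'M[R[i]]_n :=
  X *m Y - Y *m X.

Definition adjmx (X : 'M[R[i]]_2) : 'M[R[i]]_2 := map_mx Num.conj X^T.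

Definition irreducible_under (V : lmodType R[i]) (S : set (V -> V)) : Prop :=
  (exists v : V, v != 0) /\
  forall W : {pred V}, GRing.submod_closed W ->
    (forall f, S f -> forall v, v \in W -> f v \in W) ->
    (forall v, v \in W -> v = 0) \/ (forall v, v \in W).

Definition irreducible_sl2_rep (n : nat) (rho : 'M[R[i]]_2 -> 'M[R[i]]_n) :
    Prop :=
  [/\ forall a X Y, \tr X = 0 -> \tr Y = 0 ->
        rho (a *: X + Y) = a *: rho X + rho Y,
      forall X Y, \tr X = 0 -> \tr Y = 0 ->
        rho (lie_bracket X Y) = lie_bracket (rho X) (rho Y)
    & irreducible_under
        [set f : 'cV[R[i]]_n -> 'cV[R[i]]_n |
          exists2 X, \tr X = 0 & f = (fun w => rho X *m w)]].

End Sl2.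

(* The inner product ip is linear in its first argument.  Directness of the
   decomposition into the subspaces pe_grade n follows from orthogonality. *)
Record level_one_rep (R : realType) := LevelOneRep {
  pe_space :> lmodType R[i];
  pe_ip : {dot pe_space for Num.conj};
  pe_grade : nat -> {pred pe_space};
  pe_mode : 'M[R[i]]_2 -> int -> {linear pe_space -> pe_space};
  pe_D : {linear pe_space -> pe_space};
  pe_grade_submod : forall n, GRing.submod_closed (pe_grade n);
  pe_grade_findim : forall n, exists s : seq pe_space,
    forall v, v \in pe_grade n ->
      exists c : 'I_(size s) -> R[i], v = \sum_i c i *: s`_i;
  pe_grade_ortho : forall m n u v, m != n ->
    u \in pe_grade m -> v \in pe_grade n -> pe_ip u v = 0;
  pe_grade_span : forall v, exists (N : nat) (w : nat -> pe_space),
    (forall n, w n \in pe_grade n) /\ v = \sum_(n < N) w n;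
  pe_D_grade : forall n v, v \in pe_grade n -> pe_D v = n%:R *: v;
  pe_D_adj : forall u v, pe_ip (pe_D u) v = pe_ip u (pe_D v);
  pe_mode_linear : forall a X Y n v, \tr X = 0 -> \tr Y = 0 ->
    pe_mode (a *: X + Y) n v = a *: pe_mode X n v + pe_mode Y n v;
  pe_mode_adj : forall X n u v, \tr X = 0 ->
    pe_ip (pe_mode X n u) v = pe_ip u (pe_mode (adjmx X) (- n) v);
  pe_D_mode : forall X n v, \tr X = 0 ->
    pe_D (pe_mode X n v) - pe_mode X n (pe_D v) = - n%:~R *: pe_mode X n v;
  pe_mode_comm : forall X Y m n v, \tr X = 0 -> \tr Y = 0 ->
    pe_mode X m (pe_mode Y n v) - pe_mode Y n (pe_mode X m v) =
    pe_mode (lie_bracket X Y) (m + n) v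
      + (m%:~R * (m + n == 0)%:R * \tr (X *m Y)) *: v
}.
Arguments pe_ip {R} V : rename.
Arguments pe_grade {R} V : rename.
Arguments pe_mode {R} V : rename.
Arguments pe_D {R} V : rename.

Section Reps.
Variables (R : realType) (V : level_one_rep R).

Definition irreducible_rep : Prop :=
  irreducible_under
    [set f : V -> V | f = pe_D V \/
      exists X n, \tr X = 0 /\ f = pe_mode V X n].

(* pe_grade V 0, with X acting by X(0), is isomorphic to an irreducible
   representation of sl_2 of dimension 2j+1. *)
Definition lowest_energy_spin (j : R) : Prop :=
  exists (d : nat) (rho : 'M[R[i]]_2 -> 'M[R[i]]_d)
         (phi : {linear 'cV[R[i]]_d -> V}),
    [/\ d%:R = 2 * j + 1,
        irreducible_sl2_rep rho,
        injective phi,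
        forall v, v \in pe_grade V 0 <-> exists w, v = phi w
      & forall X w, \tr X = 0 -> phi (rho X *m w) = pe_mode V X 0 (phi w)].

Definition Hmode (n : int) : V -> V := pe_mode V (sl2H R) n.

Definition weight_space (m : R) : set V := [set v | Hmode 0 v = m%:C *: v].

(* \sum_(p \in A) is a sum with finite support.  Here all but finitely many
   terms vanish: a vector of energy at most N is killed by H(q) for q > N, and
   H(p), H(q) commute when p + q != 0. *)
Definition virasoro (n : int) (v : V) : V :=
  if n == 0 then
    Hmode 0 (Hmode 0 v) + 2 *: \sum_(p \in [set p : int | 0 < p])
                                  Hmode (- p) (Hmode p v)
  else \sum_(p \in [set: int]) Hmode p (Hmode (n - p) v).

Definition singular (v : V) : Prop :=
  [/\ v != 0,
      exists l : R[i], virasoro 0 v = l *: v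
    & forall n : int, 0 < n -> virasoro n v = 0].

(* v is a choice of the vector xi_k. *)
Definition is_xi (k : R) (v : V) : Prop :=
  [/\ v != 0, Hmode 0 v = k%:C *: v & forall n : int, 0 < n -> Hmode n v = 0].

(* For m in (1/2)Z the number k - m is a natural number; p is that number. *)
Definition goldstone (m : R) (v : V) : Prop :=
  exists (k : R) (r p : nat) (xi : V),
    [/\ k = `|m| + r%:R, k - m = p%:R, is_xi k xi
      & v = iter p (pe_mode V (sl2F R) 0) xi].

End Reps.

Arguments irreducible_rep {R} V.
Arguments lowest_energy_spin {R} V j.
Arguments Hmode {R} V n v : rename.
Arguments weight_space {R} V m.
Arguments virasoro {R} V n v.
Arguments singular {R} V v.
Arguments is_xi {R} V k v.
Arguments goldstone {R} V m v.

(* Main.v *)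
(* The modes of [ad F(0)^i (\sum_p E(p) E(n - p))] span a space of operators which is stable under
   commutators with the modes X(m); at level one this needs no correction terms.  They kill the
   lowest energy space, hence vanish by irreducibility, and so
   [\sum_p (H(p) E(n - p) + E(p) H(n - p)) = 0], likewise with F for E.  For F this says that F(0)
   commutes with the L_n, so that Goldstone vectors are singular.  Applied to a vector [xi] of
   weight k killed by all H(n), n > 0, it is a recursion expressing all E(n) xi through
   E(-2k-1) xi by means of the H(-r): the H(-r) therefore generate the space from a single line of
   such vectors in each weight.

   Conversely let v be singular of weight m and energy l.  The vector-valued polynomial
   [q(t) = exp (- \sum_(s > 0) t^s H(s) / s) v] satisfies a second order equation whose top
   coefficient is l = (d - m)^2, where d is its degree; thus l = k^2 for some k in |m| + N.  In
   weight m and energy l the singular vectors form a space of dimension at most one, since such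
   a v is determined by H(1)^(l - m^2) v, a multiple of xi_m.  Hence v is proportional to
   F(0)^(k - m) xi_k. *)

(* The null identity starts from E(0)^2 = 0 on the lowest energy space, which holds because that
   space has dimension at most two. Its sums are delicate: H(p) E(n - p) v does not vanish for large
   p but stabilises at E(n) v, so only symmetrised sums are finite, and shifting an index inside one
   half costs a multiple of E(n) v.

   Positivity of the inner product enters the second half. In weight m, L_0 - m^2 is a sum of terms
   2 H(n)^* H(n), hence L_0 >= m^2, and equality forces H(n) v = 0 for all n > 0. This turns l = (d
   - m)^2 into l = k^2 with k >= |m|, and it bounds the degree of the words in H(n), n > 0, that do
   not kill v.

   The polynomial q(t) is a translation: if H(s) is viewed as a multiple of the derivative in an
   oscillator variable, the exponential shifts that variable by a multiple of t^s. Its degree d is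
   not known beforehand. Only the coefficient of t^d is compared, because there the creation modes
   H(-r) recombine into L_0.

   Weights are handled through the integer 2m ([a], [z], [xi_weight]). *)
Require Import Defs.
From mathcomp Require Import all_boot all_order all_algebra.
From mathcomp Require Import all_classical all_reals.
From mathcomp Require Import complex.
From mathcomp Require Import zify ring.

Set Implicit Arguments.
Unset Strict Implicit.
Unset Printing Implicit Defensive.

Import Order.TTheory GRing.Theory Num.Theory.
Local Open Scope ring_scope.

(** * Sums over the integers with finite support *)

Section FiniteSupportSums.
Variables (K : nzRingType) (U : lmodType K).
Implicit Types (f g : int -> U) (c : U) (m n : int).

Definition isum f : U := (\sum_(p \in [set: int]) f p)%classic.

Definition fin_supp f := exists B : nat, forall p : int, (B < `|p|)%N -> f p = 0.

(** Such an [f] need not be summable, but its differences under shifts are. Products like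
    [h(p) e(n - p) v] have this shape: zero for very negative [p], one fixed vector for large
    [p]. *)
Definition from_below_to c f := exists B : nat,
  (forall p : int, p < - B%:Z -> f p = 0) /\ (forall p : int, B%:Z < p -> f p = c).

Lemma isumE (B : nat) f : (forall p : int, (B < `|p|)%N -> f p = 0) ->
  isum f = \sum_(i < B.*2.+1) f (i%:Z - B%:Z).
Proof.
move=> f0; pose r := [seq i%:Z - B%:Z | i <- iota 0 B.*2.+1].
rewrite /isum (fsbigE r) //.
- rewrite (eq_bigl xpredT); last by move=> i; apply/mem_set.
  by rewrite big_map -(big_mkord xpredT (fun i => f (i%:Z - B%:Z))) /index_iota subn0.
- by rewrite map_inj_uniq ?iota_uniq // => x y /addIr [].
- move=> p _ /mapP pr; apply: f0; rewrite ltnNge; apply/negP => pB; apply: pr.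
  by exists (absz (p + B%:Z)%R); rewrite ?mem_iota; lia.
Qed.

Lemma fin_suppD f g : fin_supp f -> fin_supp g -> fin_supp (fun p => f p + g p).
Proof.
move=> [B fB] [C gC]; exists (maxn B C) => p; rewrite gtn_max => /andP[pB pC].
by rewrite fB ?gC ?addr0.
Qed.

Lemma fin_suppZ a f : fin_supp f -> fin_supp (fun p => a *: f p).
Proof. by move=> [B fB]; exists B => p pB; rewrite fB ?scaler0. Qed.

Lemma eq_fin_supp f g : f =1 g -> fin_supp f -> fin_supp g.
Proof. by move=> fg [B fB]; exists B => p pB; rewrite -fg fB. Qed.

Lemma fin_supp_shift m f : fin_supp f -> fin_supp (fun p => f (p + m)).
Proof. by move=> [B fB]; exists (B + `|m|)%N => p pB; apply: fB; lia. Qed.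

Lemma fin_supp_delta m c : fin_supp (fun p => (p == m)%:R *: c).
Proof. by exists `|m|%N => p pB; rewrite (_ : (p == m) = false) ?scale0r //; lia. Qed.

Lemma eq_isum f g : f =1 g -> isum f = isum g.
Proof. by move=> fg; congr isum; apply/funext. Qed.

Lemma isum0 f : (forall p, f p = 0) -> isum f = 0.
Proof. by move=> f0; rewrite /isum fsbig1. Qed.

Lemma isum_reindex (h : int -> int) f : bijective h -> isum (f \o h) = isum f.
Proof.
by move=> bh; rewrite /isum [RHS](reindex_fsbigT h).
Qed.

Lemma isum_shift m f : isum (fun p => f (p + m)) = isum f.
Proof.
apply: (@isum_reindex (fun p => p + m) f).
by exists (fun p => p - m) => p; rewrite ?addrK ?subrK.
Qed.

Lemma isum_rev m f : isum (fun p => f (m - p)) = isum f.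
Proof.
apply: (@isum_reindex (fun p => m - p) f).
by exists (fun p => m - p) => p; rewrite opprB addrCA subrr addr0.
Qed.

Lemma isumD f g : fin_supp f -> fin_supp g ->
  isum (fun p => f p + g p) = isum f + isum g.
Proof.
move=> [B fB] [C gC].
have le1 p : (maxn B C < `|p|)%N -> f p = 0 by rewrite gtn_max => /andP[/fB].
have le2 p : (maxn B C < `|p|)%N -> g p = 0 by rewrite gtn_max => /andP[_ /gC].
rewrite (isumE le1) (isumE le2) -big_split; apply: isumE => p pM.
by rewrite le1 ?le2 ?addr0.
Qed.

Lemma isumZ a f : fin_supp f -> isum (fun p => a *: f p) = a *: isum f.
Proof.
move=> [B fB]; rewrite (isumE fB) scaler_sumr; apply: isumE => p pB.
by rewrite fB ?scaler0.
Qed.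

Lemma isumB f g : fin_supp f -> fin_supp g ->
  isum (fun p => f p - g p) = isum f - isum g.
Proof.
move=> ff fg; rewrite -[in RHS]scaleN1r -isumZ // -isumD //; last exact: fin_suppZ.
by apply: eq_isum => p; rewrite scaleN1r.
Qed.

Lemma isum_delta m c : isum (fun p => (p == m)%:R *: c) = c.
Proof.
rewrite (@isumE `|m|%N); last first.
  by move=> p pB; rewrite (_ : (p == m) = false) ?scale0r //; lia.
have lt : (absz (m + (absz m)%:Z)%R < (absz m).*2.+1)%N by lia.
rewrite (bigD1 (Ordinal lt)) //= big1 => [|i /eqP im]; last first.
  rewrite (_ : (_ == m) = false) ?scale0r //; apply/eqP => e; apply: im.
  by apply/val_inj => /=; lia.
by rewrite (_ : (_ == m) = true) ?scale1r ?addr0 //; lia.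
Qed.

(** Both sides are additive in [m], which leaves [m = 1], where the sum telescopes from 0 up to [c].
    The value [m c] is the price of shifting an index in a sum that does not converge by itself. *)
Lemma isum_telescope m c f : from_below_to c f ->
  fin_supp (fun p => f (p + m) - f p) /\
  isum (fun p => f (p + m) - f p) = m%:~R *: c.
Proof.
move=> [B [f0 fc]].
have fin k : fin_supp (fun p => f (p + k) - f p).
  exists (B + `|k|)%N => p pB; have [p0|p0] := ltrP p 0.
    by rewrite !f0 ?subr0 //; lia.
  by rewrite !fc ?subrr //; lia.
split=> //; have step : isum (fun p => f (p + 1) - f p) = c.
  rewrite (@isumE B.+1) => [|p pB].
    rewrite -(big_mkord xpredT (fun i => f (i%:Z - B.+1%:Z + 1) - f (i%:Z - B.+1%:Z))).
    rewrite (eq_bigr (fun i : nat => f (i.+1%:Z - B.+1%:Z) - f (i%:Z - B.+1%:Z))).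
      by rewrite telescope_sumr //= fc ?f0 ?subr0 //; lia.
    by move=> i _; congr (f _ - _); lia.
  have [p0|p0] := ltrP p 0; first by rewrite !f0 ?subr0 //; lia.
  by rewrite !fc ?subrr //; lia.
have add k l : isum (fun p => f (p + (k + l)) - f p)
    = isum (fun p => f (p + k) - f p) + isum (fun p => f (p + l) - f p).
  rewrite -(isum_shift l (fun p => f (p + k) - f p)) -isumD.
  - by apply: eq_isum => p; rewrite [RHS]addrA subrK -addrA [l + k]addrC.
  - exact: (fin_supp_shift l (fin k)).
  - exact: fin.
elim: m => [|k IH|k IH].
- by rewrite scale0r; apply: isum0 => p; rewrite addr0 subrr.
- by rewrite -addn1 PoszD add IH step intrD scalerDl scale1r.
- have := add (- k.+1%:Z) 1; rewrite (_ : - k.+1%:Z + 1 = - k%:Z); last by lia.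
  rewrite IH step => /(canLR (addrK _)) <-; apply/(canLR (addrK _)).
  by rewrite -[X in _ + X]scale1r -scalerDl -(intrD _ _ 1); congr (_%:~R *: _); lia.
Qed.

(** Allows L_0, defined through positive [p] only, to be treated as a sum over all integers like the
    other L_n. *)
Lemma isum_even f : fin_supp f -> (forall p, f (- p) = f p) ->
  isum f = f 0 + 2 *: (\sum_(p \in [set p : int | (0 < p)%R]) f p)%classic.
Proof.
move=> [B fB] fN; rewrite (isumE fB).
have -> : (\sum_(p \in [set p : int | (0 < p)%R]) f p)%classic = \sum_(i < B) f i.+1%:Z.
  pose r := [seq i.+1%:Z | i <- iota 0 B].
  rewrite (fsbigE r).
  - rewrite big_map -(big_mkord xpredT (fun i => f i.+1%:Z)) /index_iota subn0.
    by apply: eq_bigl => i; apply/mem_set.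
  - by rewrite map_inj_uniq ?iota_uniq // => x y [].
  - by move=> p /= /mapP [i _ ->].
  - move=> p /= p0 /mapP pr; apply: fB; rewrite ltnNge; apply/negP => pB; apply: pr.
    by exists `|p|.-1%N; rewrite ?mem_iota; lia.
rewrite -(big_mkord xpredT (fun i => f (i%:Z - B%:Z))).
rewrite (@big_cat_nat _ _ _ B) //=; last by lia.
rewrite [X in _ + X](_ : _ = f 0 + \sum_(i < B) f i.+1%:Z); last first.
  rewrite big_ltn; last by lia.
  rewrite subrr; congr (_ + _).
  rewrite -[B.+1]addn0 (_ : B.*2.+1 = (B + B.+1)%N); last by lia.
  rewrite addn0 -{1}[B.+1]add0n big_addn (_ : (B + B.+1 - B.+1 = B)%N); last by lia.
  by rewrite big_mkord; apply: eq_bigr => i _; congr f; lia.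
rewrite [X in X + _](_ : _ = \sum_(i < B) f i.+1%:Z); last first.
  rewrite big_nat_rev /= big_mkord; apply: eq_bigr => i _.
  by rewrite -fN; congr f; have := ltn_ord i; lia.
by rewrite scaler_nat mulr2n addrCA.
Qed.

End FiniteSupportSums.

Lemma isum_map (K : nzRingType) (U W : lmodType K) (g : {linear U -> W}) (f : int -> U) :
  fin_supp f -> g (isum f) = isum (g \o f) /\ fin_supp (g \o f).
Proof.
move=> [B fB]; split; last by exists B => p pB /=; rewrite fB ?linear0.
rewrite (isumE fB) linear_sum; apply/esym; apply: isumE => p pB /=.
by rewrite fB ?linear0.
Qed.

(** * Modes of sl2-triples *)

(** Here [h] is half a coroot, whence the factor 2 in [e, f] = 2 h and the trace 1/2 of h^2. The
    trace fields are the coefficients of the central terms. *)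
Record sl2_triple (R : realType) (e f h : 'M[R[i]]_2) : Prop := Sl2Triple {
  tre : \tr e = 0;
  trf : \tr f = 0;
  trh : \tr h = 0;
  lief : lie_bracket e f = 2 *: h;
  lihe : lie_bracket h e = e;
  lihf : lie_bracket h f = - f;
  tref : \tr (e *m f) = 1;
  trhh : 2 * \tr (h *m h) = 1;
  trhe : \tr (h *m e) = 0;
  trhf : \tr (h *m f) = 0;
  tree : \tr (e *m e) = 0;
  trff : \tr (f *m f) = 0 }.

Lemma mxtrace2 (K : nzRingType) (X : 'M[K]_2) : \tr X = X 0 0 + X 1 1.
Proof.
by rewrite /mxtrace !big_ord_recl big_ord0 addr0; congr (_ + X _ _); apply/val_inj.
Qed.

Lemma ord2P (i : 'I_2) : i = 0 \/ i = 1.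
Proof. by case: i => [[|[|//]] ?]; [left|right]; apply/val_inj. Qed.

Section MatrixTriples.
Variable R : realType.
Let K := R[i].

Ltac mx2 := apply/matrixP => -[[|[|//]] ?] [[|[|//]] ?];
  rewrite /lie_bracket /sl2E /sl2F /sl2H !mxE ?big_ord_recl ?big_ord0 ?mxE /=.

Lemma sl2_tripleEFH : sl2_triple (sl2E R) (sl2F R) (sl2H R).
Proof.
split; rewrite ?mxtrace2; try (by mx2; field);
 by rewrite /sl2E /sl2F /sl2H !mxE ?big_ord_recl ?big_ord0 ?mxE /=; field.
Qed.

Lemma sl2_triple_opp (e f h : 'M[K]_2) :
  sl2_triple e f h -> sl2_triple f e (- h).
Proof.
case=> te tf th ef he hf tef thh thhe thf tee tff; split => //.
- by rewrite linearN /= th oppr0.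
- by rewrite /lie_bracket -opprB -/(lie_bracket e f) ef scalerN.
- by rewrite /lie_bracket mulNmx mulmxN -opprD -/(lie_bracket h f) hf opprK.
- by rewrite /lie_bracket mulNmx mulmxN -opprD -/(lie_bracket h e) he.
- by rewrite mxtrace_mulC.
- by rewrite mulNmx mulmxN opprK.
- by rewrite mulNmx linearN /= thf oppr0.
- by rewrite mulNmx linearN /= thhe oppr0.
Qed.

(* The two triples exchanged by the Weyl element; each statement about [e]
   then also holds for [f]. *)
Variant std_triple : 'M[K]_2 -> 'M[K]_2 -> 'M[K]_2 -> Prop :=
  | TripleEFH : std_triple (sl2E R) (sl2F R) (sl2H R)
  | TripleFEH : std_triple (sl2F R) (sl2E R) (- sl2H R).

Lemma std_triple_sl2 e f h : std_triple e f h -> sl2_triple e f h.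
Proof.
by case; [exact: sl2_tripleEFH | apply: sl2_triple_opp; exact: sl2_tripleEFH].
Qed.

Lemma traceless_sl2E (X : 'M[K]_2) : \tr X = 0 ->
  X = X 0 1 *: sl2E R + (X 1 0 *: sl2F R + (2 * X 0 0) *: sl2H R).
Proof.
rewrite mxtrace2 => /eqP; rewrite addr_eq0 => /eqP X00.
apply/matrixP => i j; case: (ord2P i) => ->; case: (ord2P j) => ->;
  by rewrite /sl2E /sl2F /sl2H !mxE /= ?X00; field.
Qed.

Lemma adjmx_sl2H : adjmx (sl2H R) = sl2H R.
Proof.
rewrite /adjmx; mx2; rewrite ?subrr ?subr0 ?sub0r ?mulr0 ?mulrN ?mulr1 ?rmorphN ?rmorph0 //;
by rewrite fmorphV rmorph_nat.
Qed.

End MatrixTriples.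

(** * The inner product, also as a test for equality of vectors *)

Section InnerProduct.
Variables (R : realType) (V : level_one_rep R).
Local Notation K := R[i].
Local Notation ip := (pe_ip V).
Implicit Types (u v w : V) (a : K).

Lemma ipDl u v w : ip (u + v) w = ip u w + ip v w.
Proof. exact: linearDl. Qed.
Lemma ipNl u w : ip (- u) w = - ip u w.
Proof. exact: linearNl. Qed.
Lemma ipZl a u w : ip (a *: u) w = a * ip u w.
Proof. exact: linearZl_LR. Qed.
Lemma ip0l w : ip 0 w = 0.
Proof. exact: linear0l. Qed.
Lemma ip0r w : ip w 0 = 0.
Proof. exact: linear0r. Qed.
Lemma ip_suml (I : Type) (r : seq I) (P : pred I) (F : I -> V) w :
  ip (\sum_(i <- r | P i) F i) w = \sum_(i <- r | P i) ip (F i) w.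
Proof. exact: linear_sumlz. Qed.
Lemma ip_sumr (I : Type) (r : seq I) (P : pred I) (F : I -> V) w :
  ip w (\sum_(i <- r | P i) F i) = \sum_(i <- r | P i) ip w (F i).
Proof. exact: linear_sumr. Qed.
Lemma ipC u v : ip u v = (ip v u)^*.
Proof. by rewrite hermC mul1r. Qed.
Lemma ip_eq0C u v : ip u v = 0 -> ip v u = 0.
Proof. by move=> uv; rewrite ipC uv rmorph0. Qed.
Lemma ip_gt0 u : u != 0 -> 0 < ip u u.
Proof. exact: neq0_dnorm_gt0. Qed.
Lemma ip_eq0 u : ip u u = 0 -> u = 0.
Proof. by have [//|/ip_gt0 + u0] := eqVneq u 0; rewrite u0 ltxx. Qed.
Lemma ip_ge0 u : 0 <= ip u u.
Proof. by have [->|/ip_gt0/ltW//] := eqVneq u 0; rewrite ip0l. Qed.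

Lemma ip_ext u v : (forall w, ip u w = ip v w) -> u = v.
Proof.
move=> uv; apply/subr0_eq/ip_eq0.
by rewrite [X in X = _]ipDl ipNl uv subrr.
Qed.

End InnerProduct.

(* Identities between vectors are tested against all vectors, so that [ring]
   applies in the field of scalars. *)
Ltac vring :=
  apply: ip_ext => ?; rewrite ?(ipDl, ipNl, ipZl, ip0l); ring.

(** * Commutation of modes, energy bounds, irreducibility as induction *)

Section Modes.
Variables (R : realType) (V : level_one_rep R).
Local Notation K := R[i].
Local Notation md := (pe_mode V).
Local Notation D := (pe_D V).
Implicit Types (u v w : V) (X Y e f h : 'M[K]_2) (m n : int).

Lemma mode0 n v : md 0 n v = 0.
Proof.
have := pe_mode_linear (l := V) 1 n v (linear0 (@mxtrace K 2)) (linear0 (@mxtrace K 2)).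
rewrite scale1r addr0 scale1r => /eqP; rewrite -subr_eq subrr => /eqP <- //.
Qed.

Lemma modeD X Y n v : \tr X = 0 -> \tr Y = 0 -> md (X + Y) n v = md X n v + md Y n v.
Proof.
by move=> tX tY; have := pe_mode_linear (l := V) 1 n v tX tY; rewrite !scale1r.
Qed.

Lemma modeZ a X n v : \tr X = 0 -> md (a *: X) n v = a *: md X n v.
Proof.
move=> tX; have := pe_mode_linear (l := V) a n v tX (linear0 (@mxtrace K 2)).
by rewrite mode0 !addr0.
Qed.

Lemma modeN X n v : \tr X = 0 -> md (- X) n v = - md X n v.
Proof. by move=> tX; rewrite -[- X]scaleN1r modeZ // scaleN1r. Qed.

Lemma modeC X Y m n v : \tr X = 0 -> \tr Y = 0 ->
  md X m (md Y n v) = md Y n (md X m v) + md (lie_bracket X Y) (m + n) v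
    + (m%:~R * (m + n == 0)%:R * \tr (X *m Y)) *: v.
Proof.
by move=> tX tY; rewrite -addrA -(pe_mode_comm m n v tX tY) addrC subrK.
Qed.

Lemma D_mode X n v : \tr X = 0 ->
  D (md X n v) = md X n (D v) - n%:~R *: md X n v.
Proof.
by move=> tX; rewrite -scaleNr -(pe_D_mode (l := V) n v tX) addrC subrK.
Qed.

Lemma H_adj n u v : pe_ip V (Hmode V n u) v = pe_ip V u (Hmode V (- n) v).
Proof.
by rewrite /Hmode pe_mode_adj ?adjmx_sl2H //; exact: (sl2_tripleEFH R).(trh).
Qed.

Section Triple.
Variables (e f h : 'M[K]_2) (T : sl2_triple e f h).

Lemma mode_ee m n v : md e m (md e n v) = md e n (md e m v).
Proof.
by rewrite modeC ?T.(tre) // T.(tree) mulr0 scale0r addr0 /lie_bracket subrr mode0 addr0.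
Qed.

Lemma mode_he m n v : md h m (md e n v) = md e n (md h m v) + md e (m + n) v.
Proof. by rewrite modeC ?T.(tre) ?T.(trh) // T.(trhe) T.(lihe) mulr0 scale0r addr0. Qed.

Lemma mode_hf m n v : md h m (md f n v) = md f n (md h m v) - md f (m + n) v.
Proof.
by rewrite modeC ?T.(trf) ?T.(trh) // T.(trhf) T.(lihf) modeN ?T.(trf) // mulr0 scale0r addr0.
Qed.

Lemma mode_ef m n v : md e m (md f n v) =
  md f n (md e m v) + 2 *: md h (m + n) v + (m%:~R * (m + n == 0)%:R) *: v.
Proof.
by rewrite modeC ?T.(tre) ?T.(trf) // T.(tref) T.(lief) mulr1 modeZ ?T.(trh).
Qed.

Lemma mode_hh m n v :
  md h m (md h n v) = md h n (md h m v) + (m%:~R / 2 * (m + n == 0)%:R) *: v.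
Proof.
rewrite modeC ?T.(trh) // /lie_bracket subrr mode0 addr0; congr (_ + _ *: _).
have -> : \tr (h *m h) = 2^-1 by apply: (mulfI (x := 2)); rewrite ?T.(trhh) ?divff ?pnatr_eq0.
by field.
Qed.

End Triple.

(** [D] is self-adjoint, so [v] is orthogonal to every grade, whose eigenvalue is non-negative; the
    grades span, so [v] is orthogonal to itself. *)
Lemma D_eigen_neg v (k : int) : k < 0 -> D v = k%:~R *: v -> v = 0.
Proof.
move=> k0 Dv; have [N [w [wn vE]]] := pe_grade_span v.
apply: ip_eq0; rewrite {2}vE ip_sumr big1 // => i _.
have := pe_D_adj v (w i); rewrite Dv ipZl (pe_D_grade (wn i)) linearZr_LR /= rmorph_nat.
move/eqP; rewrite -subr_eq0 -mulrBl mulf_eq0 => /orP [|/eqP//].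
by rewrite subr_eq0 [X in _ == X]pmulrn eqr_int; lia.
Qed.

(** The components are eigenvectors of [D] rather than members of [pe_grade], because it is the
    former that the relation [D, X(n)] = -n X(n) directly propagates through modes. *)
Definition energy_below (N : nat) v := exists w : nat -> V,
  (forall n : nat, D (w n) = n%:R *: w n) /\ v = \sum_(n < N) w n.

Lemma energy_below_exists v : exists N, energy_below N v.
Proof.
have [N [w [wn vE]]] := pe_grade_span v; exists N, w; split=> // n.
exact: pe_D_grade (wn n).
Qed.

Lemma energy_below_mode X (s N : nat) v : \tr X = 0 ->
  energy_below N v -> energy_below (N - s) (md X s%:Z v).
Proof.
move=> tX [w [wn vE]]; exists (fun n : nat => md X s%:Z (w (n + s)%N)); split=> [n|].
  by rewrite D_mode // wn linearZ -scalerBl natrD addrK.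
have low (n : nat) : (n < s)%N -> md X s%:Z (w n) = 0.
  move=> ns; apply: (@D_eigen_neg _ (n%:Z - s%:Z)); first by lia.
  by rewrite D_mode // wn linearZ /= -scalerBl rmorphB.
rewrite vE linear_sum /= -(big_mkord xpredT (fun n : nat => md X s%:Z (w n))).
have [Ns|sN] := leqP N s.
  rewrite (eqP Ns) big_ord0 big_nat_cond big1 // => i /andP [/andP [_ iN] _].
  by apply: low; apply: leq_trans iN Ns.
rewrite (@big_cat_nat _ _ _ s) //=; last exact: ltnW.
rewrite big_nat_cond big1 ?add0r => [|i /andP [/andP [_ iN] _]]; last exact: low.
by rewrite -{1}[s]add0n big_addn big_mkord.
Qed.

Lemma energy_below_leq N M v : (N <= M)%N -> energy_below N v -> energy_below M v.
Proof.
move=> NM [w [wn vE]]; exists (fun n : nat => if (n < N)%N then w n else 0); split=> [n|].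
  by case: ifP => _; rewrite ?wn // linear0 scaler0.
rewrite -big_mkcond vE (big_ord_widen M) //.
Qed.

Lemma energy_below0 v : energy_below 0 v -> v = 0.
Proof. by move=> [w [_ ->]]; rewrite big_ord0. Qed.

Lemma energy_below_linear N a u v :
  energy_below N u -> energy_below N v -> energy_below N (a *: u + v).
Proof.
move=> [w [wn ->]] [x [xn ->]]; exists (fun n : nat => a *: w n + x n); split=> [n|].
  by rewrite linearP /= wn xn scalerDr !scalerA mulrC.
by rewrite big_split scaler_sumr.
Qed.

Lemma energy_below_vanish N X n v : \tr X = 0 -> energy_below N v -> N%:Z <= n ->
  md X n v = 0.
Proof.
case: n => // s tX vN Ns; apply: energy_below0.
by have := energy_below_mode s tX vN; rewrite (_ : (N - s)%N = 0%N) //; lia.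
Qed.

Lemma mode_vanish v : exists N : nat, forall X, \tr X = 0 ->
  forall n, N%:Z <= n -> md X n v = 0.
Proof.
have [N vN] := energy_below_exists v; exists N => X tX n.
exact: energy_below_vanish.
Qed.

Lemma mode_std_closed e f h (P : V -> Prop) n v : std_triple e f h ->
  (forall a u w, P u -> P w -> P (a *: u + w)) -> P 0 ->
  P (md e n v) -> P (md f n v) -> P (md h n v) ->
  forall X, \tr X = 0 -> P (md X n v).
Proof.
move=> std Plin P0 Pe Pf Ph X tX.
have PZ a u : P u -> P (a *: u) by move=> Pu; rewrite -[_ *: _]addr0; apply: Plin.
have {std Pe Pf Ph} [PE PF PH] :
    [/\ P (md (sl2E R) n v), P (md (sl2F R) n v) & P (md (sl2H R) n v)].
  case: std Pe Pf Ph => //; split=> //; rewrite -[sl2H R]opprK modeN.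
    by rewrite -scaleN1r; apply: PZ.
  by rewrite linearN /= (sl2_tripleEFH R).(trh) oppr0.
have T := sl2_tripleEFH R.
have tZ a (Z : 'M[K]_2) : \tr Z = 0 -> \tr (a *: Z) = 0.
  by move=> tZ; rewrite linearZ /= tZ mulr0.
have [tE tF tH] := And3 T.(tre) T.(trf) T.(trh).
have tFH : \tr (X 1 0 *: sl2F R + (2 * X 0 0) *: sl2H R) = 0.
  by rewrite mxtraceD tZ // tZ // addr0.
rewrite (traceless_sl2E tX) (modeD n v (tZ _ _ tE) tFH) (modeD n v (tZ _ _ tF) (tZ _ _ tH)).
rewrite (modeZ _ n v tE) (modeZ _ n v tF) (modeZ _ n v tH).
by do 2 (apply: (Plin) => //); apply: PZ.
Qed.

Lemma mode_std_eq0 e f h n v : std_triple e f h ->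
  md e n v = 0 -> md f n v = 0 -> md h n v = 0 -> forall X, \tr X = 0 -> md X n v = 0.
Proof.
move=> std; apply: (@mode_std_closed _ _ _ (fun w => w = 0) n v std) => //.
by move=> a u w -> ->; rewrite scaler0 addr0.
Qed.

Hypothesis irr : irreducible_rep V.

(** The vectors satisfying [P] form an invariant subspace, which irreducibility makes everything as
    soon as it is non-zero. *)
Lemma irreducible_ind e f h (P : V -> Prop) : std_triple e f h ->
  P 0 -> (forall a u v, P u -> P v -> P (a *: u + v)) ->
  (forall n v, P v -> P (md e n v)) -> (forall n v, P v -> P (md f n v)) ->
  (forall n v, P v -> P (md h n v)) -> (forall v, P v -> P (D v)) ->
  (exists2 v, v != 0 & P v) -> forall v, P v.
Proof.
move=> std P0 Plin Pe Pf Ph PD [v0 v00 Pv0].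
pose W : {pred V} := fun v => `[< P v >].
case: irr => _ /(_ W) [|X|W0|WT v].
- split; first exact/asboolP.
  by move=> a u v /asboolP Pu /asboolP Pv; apply/asboolP; apply: Plin.
- case=> [->|[Y [n [tY ->]]]] v /asboolP Pv; apply/asboolP; first exact: PD.
  by apply: (mode_std_closed std Plin P0) tY; auto.
- by case/negP: v00; apply/eqP/W0/asboolP.
- exact/asboolP/WT.
Qed.

End Modes.

(** * The null vector identity *)

Section Null.
Variables (R : realType) (V : level_one_rep R).
Local Notation K := R[i].
Local Notation md := (pe_mode V).
Local Notation D := (pe_D V).
Implicit Types (u v w : V) (m n p : int).

Inductive lowered : V -> Prop :=
  | lowered_base v : v \in pe_grade V 0 -> lowered v
  | lowered_lin a u v : lowered u -> lowered v -> lowered (a *: u + v)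
  | lowered_mode X n v : \tr X = 0 -> 0 < n -> lowered v -> lowered (md X (- n) v).

Hypothesis irr : irreducible_rep V.
Hypothesis grade0_stable : forall X v, \tr X = 0 ->
  v \in pe_grade V 0 -> md X 0 v \in pe_grade V 0.
Hypothesis grade0_neq0 : exists2 v, v != 0 & v \in pe_grade V 0.

Lemma D_grade0 v : v \in pe_grade V 0 -> D v = 0.
Proof. by move=> /pe_D_grade ->; rewrite scale0r. Qed.

Lemma mode_pos_grade0 X n v : \tr X = 0 -> 0 < n -> v \in pe_grade V 0 -> md X n v = 0.
Proof.
move=> tX n0 v0; apply: (@D_eigen_neg _ _ _ (- n)); first by rewrite oppr_lt0.
by rewrite D_mode // D_grade0 // linear0 sub0r rmorphN scaleNr.
Qed.

Lemma zero_grade0 : (0 : V) \in pe_grade V 0.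
Proof. by have [] := pe_grade_submod V 0. Qed.

Lemma lowered_scale a v : lowered v -> lowered (a *: v).
Proof.
by move=> lv; rewrite -[_ *: _]addr0; apply: lowered_lin; [|exact/lowered_base/zero_grade0].
Qed.

Lemma lowered_add u v : lowered u -> lowered v -> lowered (u + v).
Proof. by move=> lu lv; rewrite -[u]scale1r; apply: lowered_lin. Qed.

(** The mode is pushed to the right through the negative modes until it reaches grade 0. The
    induction is on [lowered] with all modes quantified, since each commutator creates a new mode
    acting on a shorter word. *)
Lemma lowered_any X m v : \tr X = 0 -> lowered v -> lowered (md X m v).
Proof.
move=> tX lv; elim: lv X m tX => {v} [v v0|a u v _ IHu _ IHv|Y n v tY n0 lv IH] X m tX.
- have [m0|m0|->] := ltrgtP m 0.
  + by rewrite -[m]opprK; apply: lowered_mode; rewrite ?oppr_gt0 //; apply: lowered_base.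
  + by rewrite mode_pos_grade0 //; exact/lowered_base/zero_grade0.
  + exact/lowered_base/grade0_stable.
- by rewrite linearP; apply: lowered_lin; [exact: IHu|exact: IHv].
- rewrite modeC //; apply: lowered_add; last exact: lowered_scale.
  apply: lowered_add; first by apply: lowered_mode => //; exact: IH.
  by apply: IH; rewrite /lie_bracket linearB /= mxtrace_mulC subrr.
Qed.

Lemma lowered_all v : lowered v.
Proof.
apply: (irreducible_ind irr (TripleEFH R)) v.
- exact/lowered_base/zero_grade0.
- by move=> a u v; apply: lowered_lin.
- by move=> n v; apply/lowered_any/(sl2_tripleEFH R).(tre).
- by move=> n v; apply/lowered_any/(sl2_tripleEFH R).(trf).
- by move=> n v; apply/lowered_any/(sl2_tripleEFH R).(trh).
- move=> v; elim=> {v} [v v0|a u v _ IHu _ IHv|Y n v tY n0 lv IH].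
  + by rewrite D_grade0 //; exact/lowered_base/zero_grade0.
  + by rewrite linearP; apply: lowered_lin.
  + rewrite D_mode // -scaleNr addrC; apply: lowered_lin; exact: lowered_mode.
- by have [v v0 vg] := grade0_neq0; exists v => //; exact: lowered_base.
Qed.

(** By adjunction [u] is orthogonal to every image of a negative mode, and by its energy to grade 0;
    these span the space by [lowered_all]. *)
Lemma lowest_weight_energy u (k : int) : 0 < k -> D u = k%:~R *: u ->
  (forall X n, \tr X = 0 -> 0 < n -> md X n u = 0) -> u = 0.
Proof.
move=> k0 Du pos; apply: ip_eq0; apply: ip_eq0C.
suff: forall v, lowered v -> pe_ip V v u = 0 by apply; exact: lowered_all.
move=> v; elim=> {v} [v v0|a w v _ IHw _ IHv|Y n v tY n0 _ IH].
- have := pe_D_adj v u; rewrite D_grade0 // ip0l Du linearZr_LR /= rmorph_int.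
  by move/esym/eqP; rewrite mulf_eq0 intr_eq0 gt_eqF //= => /eqP.
- by rewrite ipDl ipZl IHw IHv mulr0 addr0.
- rewrite pe_mode_adj // opprK pos ?ip0r //.
  by rewrite /adjmx -map_trmx mxtrace_tr trace_map_mx tY rmorph0.
Qed.

Section EE.
Variables (e f h : 'M[K]_2).
Hypothesis std : std_triple e f h.
Let T := std_triple_sl2 std.
Let tE := T.(tre).
Let tF := T.(trf).
Let tH := T.(trh).

Definition ee_sum n v : V := isum (fun p => md e p (md e (n - p) v)).
Definition he_sum n v : V := isum (fun p => md h p (md e (n - p) v) + md e p (md h (n - p) v)).

Lemma mode_eh m n v : md e m (md h n v) = md h n (md e m v) - md e (n + m) v.
Proof. by rewrite (mode_he T) addrK. Qed.

Lemma mode_fe m n v : md f m (md e n v) =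
  md e n (md f m v) - 2 *: md h (n + m) v - (n%:~R * (n + m == 0)%:R) *: v.
Proof. by rewrite (mode_ef T); vring. Qed.

Lemma ee_fin n v : fin_supp (fun p => md e p (md e (n - p) v)).
Proof.
have [N vN] := mode_vanish v; exists (N + `|n|)%N => p pN.
have [p0|p0] := ltrP p 0; first by rewrite (vN _ tE (n - p)) ?linear0 //; lia.
by rewrite (mode_ee T) (vN _ tE p) ?linear0 //; lia.
Qed.

(** For large [p] the two terms become [e(n) v] and [- e(n) v]. They are not finitely supported
    separately, which is why [he_sum] keeps them under one sum. *)
Lemma he_fin n v :
  fin_supp (fun p => md h p (md e (n - p) v) + md e p (md h (n - p) v)).
Proof.
have [N vN] := mode_vanish v; exists (N + `|n|)%N => p pN.
have [p0|p0] := ltrP p 0.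
  by rewrite (vN _ tE (n - p)) ?(vN _ tH (n - p)) ?linear0 ?addr0 //; lia.
rewrite (mode_he T) (mode_eh p) (vN _ tE p) ?(vN _ tH p) ?linear0; try lia.
by rewrite !add0r addrC (_ : n - p + p = p + (n - p)) ?addNr //; lia.
Qed.

Lemma he_jump n v : from_below_to (md e n v) (fun p => md h p (md e (n - p) v)).
Proof.
have [N vN] := mode_vanish v; exists (N + `|n|)%N; split=> p pN.
  by rewrite (vN _ tE (n - p)) ?linear0 //; lia.
rewrite (mode_he T) (vN _ tH p) ?linear0 ?add0r; last by lia.
by congr (md _ _ _); lia.
Qed.

Lemma ee_sum_lin n a u v : ee_sum n (a *: u + v) = a *: ee_sum n u + ee_sum n v.
Proof.
have fu := ee_fin n u; rewrite /ee_sum -isumZ // -isumD; [|exact: fin_suppZ|exact: ee_fin].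
by apply: eq_isum => p; rewrite !linearP.
Qed.

Lemma e_ee_sum m n v : md e m (ee_sum n v) = ee_sum n (md e m v).
Proof.
rewrite /ee_sum (isum_map (md e m) (ee_fin n v)).1; apply: eq_isum => p /=.
by rewrite (mode_ee T m p) (mode_ee T m (n - p)).
Qed.

Lemma h_ee_sum m n v : md h m (ee_sum n v) = ee_sum n (md h m v) + 2 *: ee_sum (m + n) v.
Proof.
rewrite /ee_sum (isum_map (md h m) (ee_fin n v)).1 scaler_nat mulr2n.
have fs := ee_fin (m + n) v.
rewrite -{2}(isum_shift m (fun p => md e p (md e (m + n - p) v))).
rewrite -(isumD fs (fin_supp_shift m fs)) -isumD; last first.
- exact: (fin_suppD fs (fin_supp_shift m fs)).
- exact: ee_fin.
apply: eq_isum => p /=; rewrite !(mode_he T m) linearD /= [RHS]addrA.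
by congr (_ + md e _ (md e _ _) + md e _ (md e _ _)); lia.
Qed.

(* Only at level one do the central term and the telescoping sums cancel. *)
Lemma f_ee_sum m n v :
  md f m (ee_sum n v) = ee_sum n (md f m v) - 2 *: he_sum (m + n) v.
Proof.
rewrite /ee_sum (isum_map (md f m) (ee_fin n v)).1.
set c := md e (m + n) v.
have [telf telE] := isum_telescope m (he_jump (m + n) v).
have hef := he_fin (m + n) v.
set J := (fun p => _ + _) in hef; set tel := (fun p => _) in telf telE.
have delta p k w : ((p == k)%:R *: w : V) = if p == k then w else 0.
  by case: ifP => _; rewrite ?scale1r ?scale0r.
(* The bracket [f, e] yields [h(p + m) e(n - p)]; rewriting it with [h(p)] costs [tel], which sums
   to [m c] and enters with factor -2. The central terms at [p = - m] and [p = m + n] contribute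
   [m c] each and cancel it. *)
have pointwise p : md f m (md e p (md e (n - p) v)) = md e p (md e (n - p) (md f m v))
    + ((- 2 *: J p + - 2 *: tel p)
    + (m%:~R *: ((p == - m)%:R *: c) + m%:~R *: ((p == m + n)%:R *: c))).
  rewrite !mode_fe !(linearB (md e p)) !(linearZ_LR (md e p)) /= /J /tel /c.
  rewrite (_ : n - p + m = m + n - p); last by lia.
  rewrite (_ : m + n - (p + m) = n - p); last by lia.
  have -> : (p%:~R * (p + m == 0)%:R) *: md e (n - p) v
      = - m%:~R *: ((p == - m)%:R *: md e (m + n) v).
    rewrite !delta addr_eq0; case: eqP => [->|_]; last by rewrite mulr0 scale0r scaler0.
    by rewrite mulr1 rmorphN; congr (_ *: md e _ v); lia.
  have -> : ((n - p)%:~R * (m + n - p == 0)%:R) *: md e p v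
      = - m%:~R *: ((p == m + n)%:R *: md e (m + n) v).
    rewrite !delta subr_eq0 eq_sym; case: eqP => [->|_]; last by rewrite mulr0 scale0r scaler0.
    by rewrite mulr1 -rmorphN; congr (_%:~R *: _); lia.
  vring.
have d1 := fin_suppZ m%:~R (fin_supp_delta (- m) c).
have d2 := fin_suppZ m%:~R (fin_supp_delta (m + n) c).
have JZ := fin_suppZ (- 2) hef; have tZ := fin_suppZ (- 2) telf.
rewrite (eq_isum pointwise) !isumD ?isumZ ?isum_delta ?telE //;
  do ?[exact: ee_fin | exact: fin_supp_delta | apply: fin_suppD => //].
rewrite -/(he_sum _ _) -/c; vring.
Qed.

Lemma D_ee_sum n v : D (ee_sum n v) = ee_sum n (D v) - n%:~R *: ee_sum n v.
Proof.
rewrite /ee_sum (isum_map D (ee_fin n v)).1 -isumZ; last exact: ee_fin.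
rewrite -isumB; [|exact: ee_fin|exact/fin_suppZ/ee_fin].
apply: eq_isum => p /=; rewrite !(D_mode _ _ tE) (linearB (md e p)) linearZ_LR /= intrB; vring.
Qed.

(** For fixed [n] the operator [ee_sum n] is a highest weight vector of weight 2 for the adjoint
    action of sl_2, so the orbit behaves as the five-dimensional representation. The factors [2 - i]
    and [i (5 - i)] below are its matrix coefficients. *)
Fixpoint ad_f_ee i n v : V :=
  if i is i'.+1 then md f 0 (ad_f_ee i' n v) - ad_f_ee i' n (md f 0 v) else ee_sum n v.

Lemma ad_f_ee_lin i n a u v : ad_f_ee i n (a *: u + v) = a *: ad_f_ee i n u + ad_f_ee i n v.
Proof.
elim: i u v => [|i IH] u v /=; first exact: ee_sum_lin.
rewrite linearP !IH linearP /=; vring.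
Qed.

Lemma ad_f_eeD i n u v : ad_f_ee i n (u + v) = ad_f_ee i n u + ad_f_ee i n v.
Proof. by rewrite -[u]scale1r ad_f_ee_lin !scale1r. Qed.

Lemma ad_f_ee0 i n : ad_f_ee i n 0 = 0.
Proof.
by have := ad_f_ee_lin i n (-1) 0 0; rewrite scaler0 addr0 scaleN1r addNr.
Qed.

Lemma ad_f_eeZ i n a v : ad_f_ee i n (a *: v) = a *: ad_f_ee i n v.
Proof. by rewrite -[a *: v]addr0 ad_f_ee_lin ad_f_ee0 addr0. Qed.

Lemma ad_f_eeB i n u v : ad_f_ee i n (u - v) = ad_f_ee i n u - ad_f_ee i n v.
Proof. by rewrite -[- v]scaleN1r ad_f_eeD ad_f_eeZ scaleN1r. Qed.

Lemma D_ad_f_ee i n v : D (ad_f_ee i n v) = ad_f_ee i n (D v) - n%:~R *: ad_f_ee i n v.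
Proof.
elim: i v => [|i IH] v /=; first exact: D_ee_sum.
rewrite linearB /= IH !(D_mode _ _ tF) IH linearB linearZ_LR /= !(scale0r, subr0); vring.
Qed.

(** By [f_ee_sum] the commutator with [f(m)] depends on [m] only through [m + n], so [f(m)] and
    [f(0)] lead to the same family of operators. The step uses that [f(m)] and [f(0)] commute. *)
Lemma f_ad_f_ee i m n v :
  md f m (ad_f_ee i n v) = ad_f_ee i n (md f m v) + ad_f_ee i.+1 (m + n) v.
Proof.
have ff k w : md f m (md f k w) = md f k (md f m w).
  exact: mode_ee (sl2_triple_opp T) _ _ _.
elim: i v => [|i IH] v.
  by rewrite /= !f_ee_sum !add0r; vring.
rewrite [ad_f_ee i.+2 _ _]/= [ad_f_ee i.+1 n _]/= [X in _ = X + _]/=.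
rewrite linearB /= ff !IH ff linearD /=; vring.
Qed.

Lemma h_ad_f_ee i m n v : md h m (ad_f_ee i n v) =
  ad_f_ee i n (md h m v) + (2 - i%:R) *: ad_f_ee i (m + n) v.
Proof.
elim: i v => [|i IH] v; first by rewrite subr0 /= h_ee_sum.
rewrite [ad_f_ee i.+1 n _]/= [X in _ = X + _]/= linearB /= !(mode_hf T) !IH !(mode_hf T) !addr0.
rewrite linearD linearZ_LR ad_f_eeB.
rewrite (f_ad_f_ee i m n v) /= mulrSr; vring.
Qed.

(** For [i = 0] the truncated [i.-1] is harmless, its coefficient being zero. *)
Lemma e_ad_f_ee i m n v : md e m (ad_f_ee i n v) =
  ad_f_ee i n (md e m v) + (i%:R * (5 - i%:R)) *: ad_f_ee i.-1 (m + n) v.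
Proof.
elim: i v => [|i IH] v; first by rewrite mul0r scale0r addr0 /= e_ee_sum.
rewrite [ad_f_ee i.+1 n _]/= [X in _ = X + _]/= linearB /= !(mode_ef T) !IH !(mode_ef T) !addr0.
rewrite linearD linearZ_LR !ad_f_eeD !ad_f_eeZ (h_ad_f_ee i m n v).
case: i IH => [|i] _; first by rewrite /=; vring.
by rewrite [ad_f_ee i.+1 (m + n) _]/= !mulrSr; vring.
Qed.

Hypothesis e_sq0 : forall v, v \in pe_grade V 0 -> md e 0 (md e 0 v) = 0.

(** For [n > 0] the energy would be negative, and for [n = 0] only [e(0) e(0)] survives, which is
    [e_sq0]. For [n < 0] the vector has positive energy and a mode [X(m)], [m > 0], sends it to
    vectors of the same kind with index [m + n], zero by induction for all [i] at once;
    [lowest_weight_energy] concludes. *)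
Lemma ad_f_ee_grade0 i n v : v \in pe_grade V 0 -> ad_f_ee i n v = 0.
Proof.
have [n0|n0] := ltrP 0 n => v0.
  apply: (@D_eigen_neg _ _ _ (- n)); first by rewrite oppr_lt0.
  by rewrite D_ad_f_ee D_grade0 // ad_f_ee0 sub0r rmorphN scaleNr.
have [k nE] : exists k : nat, n = - k%:Z by exists `|n|%N; lia.
elim/ltn_ind: k n {n0} nE v v0 i => -[|k] IH n nE v v0 i.
  rewrite nE; elim: i v v0 => [|i IHi] v v0 /=.
    rewrite /ee_sum isum0 // => p; have [p0|p0|->] := ltrgtP p 0.
    - by rewrite (mode_pos_grade0 tE _ v0) ?linear0 //; lia.
    - by rewrite (mode_ee T) (mode_pos_grade0 tE _ v0) ?linear0.
    - by rewrite subr0 e_sq0.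
  by rewrite (IHi v v0) (IHi _ (grade0_stable tF v0)) linear0 subr0.
apply: (@lowest_weight_energy _ k.+1%:Z) => //.
  by rewrite D_ad_f_ee D_grade0 // ad_f_ee0 sub0r nE rmorphN scaleNr opprK.
move=> X m tX m0.
have van j : ad_f_ee j (m + n) v = 0.
  have [mn|mn] := ltrP 0 (m + n).
    apply: (@D_eigen_neg _ _ _ (- (m + n))); first by rewrite oppr_lt0.
    by rewrite D_ad_f_ee D_grade0 // ad_f_ee0 sub0r rmorphN scaleNr.
  by apply: (IH (absz (m + n)) _ (m + n)) => //; lia.
have kill Y : \tr Y = 0 -> ad_f_ee i n (md Y m v) = 0.
  by move=> tY; rewrite mode_pos_grade0 // ad_f_ee0.
have ke : md e m (ad_f_ee i n v) = 0 by rewrite e_ad_f_ee (kill _ tE) van scaler0 addr0.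
have kf : md f m (ad_f_ee i n v) = 0 by rewrite f_ad_f_ee (kill _ tF) van addr0.
have kh : md h m (ad_f_ee i n v) = 0 by rewrite h_ad_f_ee (kill _ tH) van scaler0 addr0.
exact: (mode_std_eq0 std ke kf kh).
Qed.

Lemma ad_f_ee_eq0 i n v : ad_f_ee i n v = 0.
Proof.
suff: forall w, (forall i n, ad_f_ee i n w = 0) by [].
move=> {i n v}; apply: (irreducible_ind irr std).
- by move=> i n; exact: ad_f_ee0.
- by move=> a u v Pu Pv i n; rewrite ad_f_ee_lin Pu Pv scaler0 addr0.
- move=> m v Pv i n; have := e_ad_f_ee i m n v.
  by rewrite !Pv linear0 scaler0 addr0.
- by move=> m v Pv i n; have := f_ad_f_ee i m n v; rewrite !Pv linear0 addr0.
- move=> m v Pv i n; have := h_ad_f_ee i m n v.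
  by rewrite !Pv linear0 scaler0 addr0.
- move=> v Pv i n; have := D_ad_f_ee i n v.
  by rewrite !Pv linear0 scaler0 subr0.
- have [v v0 vg] := grade0_neq0; exists v => // i n; exact: ad_f_ee_grade0.
Qed.

Lemma he_sum_eq0 n v : he_sum n v = 0.
Proof.
have := f_ee_sum 0 n v; rewrite add0r -!/(ad_f_ee 0 n _) !ad_f_ee_eq0 linear0 sub0r.
by move/esym/eqP; rewrite oppr_eq0 scaler_eq0 pnatr_eq0 => /eqP.
Qed.

End EE.
End Null.

(** * Vacuum vectors of the Heisenberg modes *)

Lemma isum_closed (K : nzRingType) (U : lmodType K) (P : U -> Prop) (f : int -> U) :
  P 0 -> (forall u v, P u -> P v -> P (u + v)) -> (forall p, P (f p)) ->
  P (isum f).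
Proof.
move=> P0 PD Pf; rewrite /isum; by elim/big_ind: _.
Qed.

Section Vacuum.
Variables (R : realType) (V : level_one_rep R).
Local Notation K := R[i].
Local Notation md := (pe_mode V).
Local Notation D := (pe_D V).
Local Notation H := (Hmode V).
Local Notation E := (md (sl2E R)).
Local Notation F := (md (sl2F R)).
Implicit Types (u v w xi : V) (a m n p : int).

Hypothesis null : forall e f h, std_triple e f h -> forall n v, he_sum e h n v = 0 :> V.

Definition vacuum (h : 'M[K]_2) (k : K) v :=
  md h 0 v = k *: v /\ forall n : int, 0 < n -> md h n v = 0.

Section VacuumTriple.
Variables (e f h : 'M[K]_2).
Hypothesis std : std_triple e f h.
Let T := std_triple_sl2 std.

(** The null identity applied to [xi]. The coefficient collects [k + 1] from [p = 0], [k] from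
    [p = n], and [n] from the telescoping of the stable parts [t]; the two remaining halves agree
    under [p -> n - p]. *)
Lemma vacuum_recursion k xi n : vacuum h k xi ->
  (2 * k + 1 + n%:~R) *: md e n xi
    + 2 *: isum (fun p => if p < 0 then md h p (md e (n - p) xi) else 0) = 0.
Proof.
move=> [h0 hpos]; set S := fun p : int => _; set c := md e n xi.
have [N vN] := mode_vanish xi.
have finS : fin_supp S.
  exists (N + `|n|)%N => p pN; rewrite /S; case: ifP => // p0.
  by rewrite (vN _ T.(tre) (n - p)) ?linear0 //; lia.
have finSn : fin_supp (fun p => S (n - p)).
  by case: finS => B SB; exists (B + `|n|)%N => p pB; apply: SB; lia.
pose t (p : int) := if 0 < p then c else 0.
have tc : from_below_to c t.
  by exists 0%N; split=> p p0; rewrite /t; case: ltrP => //; lia.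
have [fint tE] := isum_telescope (- n) tc.
have delta p k' w : ((p == k')%:R *: w : V) = if p == k' then w else 0.
  by case: ifP => _; rewrite ?scale1r ?scale0r.
have pointwise p : md h p (md e (n - p) xi) + md e p (md h (n - p) xi)
    = (S p + S (n - p)) + (((p == 0)%:R *: ((k + 1) *: c) + (p == n)%:R *: (k *: c))
      + (-1) *: (t (p - n) - t p)).
  have -> : md h p (md e (n - p) xi) =
      S p + (p == 0)%:R *: ((k + 1) *: c) + t p.
    rewrite /S /t delta; have [p0|p0|->] := ltrgtP p 0.
    - by rewrite !addr0.
    - by rewrite (mode_he T) hpos // linear0 !add0r /c; congr (md e _ xi); lia.
    - by rewrite subr0 (mode_he T) h0 linearZ_LR /= !add0r -/c; vring.
  have -> : md e p (md h (n - p) xi) =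
      S (n - p) + (p == n)%:R *: (k *: c) - t (p - n).
    rewrite /S /t delta subr_gt0 subr_lt0 subKr; have [p0|p0|->] := ltrgtP p n.
    - by rewrite hpos ?subr_gt0 // linear0 !addr0 subr0.
    - by rewrite (mode_eh std) addr0 subrK.
    - by rewrite subrr h0 linearZ_LR /= -/c add0r subr0.
  vring.
have d1 := fin_supp_delta 0 ((k + 1) *: c); have d2 := fin_supp_delta n (k *: c).
have := null std n xi; rewrite /he_sum (eq_isum pointwise) !isumD ?isumZ //;
  do ?[exact: fin_suppD | exact: fin_suppZ | apply: fin_suppD => //].
rewrite !isum_delta tE isum_rev => eq0; rewrite -[RHS]eq0 rmorphN; vring.
Qed.

Variables (a : int) (xi : V).
Hypothesis vac : vacuum h (a%:~R / 2) xi.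

Lemma vacuum_coef n : 2 * (a%:~R / 2) + 1 + n%:~R = (a + 1 + n)%:~R :> K.
Proof. by rewrite !rmorphD /=; field. Qed.

(** Descending induction from a bound beyond which all modes kill [xi]: the recursion involves only
    indices above [n], and its coefficient [a + 1 + n] is non-zero. It degenerates exactly at
    [n = - a - 1], the one mode left free. *)
Lemma vacuum_above n : - a - 1 < n -> md e n xi = 0.
Proof.
have [N vN] := mode_vanish xi.
suff: forall j : nat, forall n, - a - 1 < n -> N%:Z - j%:Z <= n -> md e n xi = 0.
  by move=> /(_ (absz (N%:Z - n))%R) + an; apply=> //; lia.
elim=> [|j IH] {}n an jn; first by apply: (vN _ T.(tre)); lia.
have := vacuum_recursion n vac; rewrite isum0 ?scaler0 ?addr0 => [|p]; last first.
  by case: ifP => // p0; rewrite IH ?linear0 //; lia.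
move/eqP; rewrite scaler_eq0 vacuum_coef intr_eq0 => /orP [|/eqP //]; lia.
Qed.

(** Below [- a - 1] the coefficient is [- j], again invertible, so each [e(n) xi] is a combination
    of [h(p) e(n - p) xi] with [p < 0], where [n - p] is closer to the free mode. *)
Lemma vacuum_closed (P : V -> Prop) : P 0 ->
  (forall b u v, P u -> P v -> P (b *: u + v)) ->
  (forall p u, p < 0 -> P u -> P (md h p u)) ->
  P (md e (- a - 1) xi) -> forall n, P (md e n xi).
Proof.
move=> P0 Plin Ph Ptop n.
have PD u v : P u -> P v -> P (u + v) by move=> Pu Pv; rewrite -[u]scale1r; apply: Plin.
have [/vacuum_above -> //|na] := ltrP (- a - 1) n.
have [j nE] : exists j : nat, n = - a - 1 - j%:Z by exists (absz (n + a + 1)%R); lia.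
elim/ltn_ind: j n nE {na} => j IH n nE.
have [j0|j0] := posnP j; first by rewrite nE j0 subr0.
have := vacuum_recursion n vac; rewrite vacuum_coef => /eqP.
have : (a + 1 + n)%:~R != 0 :> K by rewrite intr_eq0; lia.
set S := isum _; set c := _%:~R => c0; rewrite addr_eq0 => /eqP rec.
have -> : md e n xi = - (2 * c^-1) *: S + 0.
  by rewrite -[LHS](scalerK c0) rec addr0 scalerN scaleNr scalerA mulrC.
apply: Plin => //; apply: isum_closed => // p; case: ifP => // p0; apply: Ph => //.
have [/vacuum_above -> //|pa] := ltrP (- a - 1) (n - p).
have [m nm] : exists m : nat, n - p = - a - 1 - m%:Z.
  by exists (absz (- a - 1 - (n - p))%R); lia.
by apply: (IH m _ _ nm); lia.
Qed.

Lemma vacuum_step : vacuum h ((a + 2)%:~R / 2) (md e (- a - 1) xi).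
Proof.
have [h0 hpos] := vac; split=> [|n n0]; rewrite (mode_he T).
  by rewrite h0 linearZ_LR /= add0r rmorphD /= mulrDl divff ?pnatr_eq0 //; vring.
by rewrite hpos // linear0 add0r vacuum_above //; lia.
Qed.

End VacuumTriple.

Lemma std_triple_opp e f h : std_triple e f h -> std_triple f e (- h :> 'M[K]_2).
Proof. by case; [exact: TripleFEH|rewrite opprK; exact: TripleEFH]. Qed.

Lemma vacuum_opp h a v : \tr h = 0 ->
  vacuum h (a%:~R / 2) v -> vacuum (- h) ((- a)%:~R / 2) v.
Proof.
move=> th [h0 hpos]; split=> [|n n0]; rewrite modeN //; last by rewrite hpos // oppr0.
by rewrite h0 rmorphN mulNr scaleNr.
Qed.

(** [f(a + 1)] kills [xi] by [vacuum_above] for the opposite triple. The commutator leaves [- a]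
    from [- 2 h(0)] and [a + 1] from the central term, in total 1. Hence steps between neighbouring
    weights never reach zero. *)
Lemma vacuum_step_inv e f h a xi : std_triple e f h -> vacuum h (a%:~R / 2) xi ->
  md f (a + 1) (md e (- a - 1) xi) = xi.
Proof.
move=> std vac; rewrite (mode_fe std) (_ : - a - 1 + (a + 1) = 0); last by lia.
have th := (std_triple_sl2 std).(trh).
rewrite (vacuum_above (std_triple_opp std) (vacuum_opp th vac)); last by lia.
rewrite linear0 vac.1 eqxx mulr1 scalerA mulrC divfK ?pnatr_eq0 //.
rewrite !rmorphD !rmorphN /=; vring.
Qed.

Section VacuumLine.
Variables (a0 : int) (xi0 : V).
Hypothesis irr : irreducible_rep V.
Hypothesis xi0_neq0 : xi0 != 0.
Hypothesis vac0 : vacuum (sl2H R) (a0%:~R / 2) xi0.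
Hypothesis D_xi0 : exists c, D xi0 = c *: xi0.
Let tE := (sl2_tripleEFH R).(tre).
Let tF := (sl2_tripleEFH R).(trf).
Let tH := (sl2_tripleEFH R).(trh).

Fixpoint xi_up (i : nat) : V :=
  if i is i'.+1 then E (- (a0 + 2 * i'%:Z) - 1) (xi_up i') else xi0.
Fixpoint xi_down (i : nat) : V :=
  if i is i'.+1 then F (a0 - 2 * i'%:Z - 1) (xi_down i') else xi0.
Definition vacuum_xi (i : int) : V :=
  match i with Posz i' => xi_up i' | Negz i' => xi_down i'.+1 end.
Definition xi_weight (i : int) : int := a0 + 2 * i.

Lemma vacuum_stepF a v : vacuum (sl2H R) (a%:~R / 2) v ->
  vacuum (sl2H R) ((a - 2)%:~R / 2) (F (a - 1) v).
Proof.
move=> vac; have := vacuum_step (TripleFEH R) (vacuum_opp tH vac).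
have tNH := (sl2_triple_opp (sl2_tripleEFH R)).(trh).
by move/(vacuum_opp tNH); rewrite !opprK opprD !opprK.
Qed.

Lemma vacuum_step_invF a v : vacuum (sl2H R) (a%:~R / 2) v ->
  E (- (a - 2) - 1) (F (a - 1) v) = v.
Proof.
move=> vac; have := vacuum_step_inv (TripleFEH R) (vacuum_opp tH vac).
by rewrite opprK (_ : - (a - 2) - 1 = - a + 1) //; lia.
Qed.

Lemma xi_down_vacuum i : vacuum (sl2H R) ((a0 - 2 * i%:Z)%:~R / 2) (xi_down i).
Proof.
elim: i => [|i IH]; first by rewrite mulr0 subr0.
by rewrite (_ : _ - _ = a0 - 2 * i%:Z - 2) ?[xi_down _]/=; [exact: vacuum_stepF|lia].
Qed.

Lemma xi_vacuum i : vacuum (sl2H R) ((xi_weight i)%:~R / 2) (vacuum_xi i).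
Proof.
case: i => i; last first.
  have := xi_down_vacuum i.+1; rewrite (_ : _ - _ = xi_weight (Negz i)) // /xi_weight NegzE; lia.
elim: i => [|i IH]; first by rewrite /xi_weight mulr0 addr0.
have := vacuum_step (TripleEFH R) IH; rewrite (_ : _ + 2 = xi_weight i.+1) //.
rewrite /xi_weight; lia.
Qed.

Lemma E_xi i : E (- xi_weight i - 1) (vacuum_xi i) = vacuum_xi (i + 1).
Proof.
case: i => i; first by rewrite -PoszD addn1.
have -> : Negz i + 1 = - i%:Z by lia.
have := vacuum_step_invF (xi_down_vacuum i).
rewrite (_ : - _ - 1 = - xi_weight (Negz i) - 1); last by rewrite /xi_weight NegzE; lia.
by rewrite [vacuum_xi (Negz i)]/= => ->; case: i.
Qed.

Lemma F_xi i : F (xi_weight i - 1) (vacuum_xi i) = vacuum_xi (i - 1).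
Proof.
have := vacuum_step_inv (TripleEFH R) (xi_vacuum (i - 1)).
rewrite E_xi subrK => <-; congr (F _ _); rewrite /xi_weight; lia.
Qed.

Lemma xi_neq0 i : vacuum_xi i != 0.
Proof.
have step k : (vacuum_xi k == 0) = (vacuum_xi (k + 1) == 0).
  apply/eqP/eqP => k0; first by rewrite -E_xi k0 linear0.
  have -> : k = k + 1 - 1 by rewrite addrK.
  by rewrite -F_xi k0 linear0.
case: i => i; elim: i => [|i IH] //.
- by rewrite -addn1 PoszD -step.
- by rewrite step.
- by rewrite step (_ : Negz i.+1 + 1 = Negz i) //; lia.
Qed.

Lemma D_xi i : exists c, D (vacuum_xi i) = c *: vacuum_xi i.
Proof.
have sc X n v c : \tr X = 0 -> D v = c *: v -> exists c', D (md X n v) = c' *: md X n v.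
  by move=> tX Dv; exists (c - n%:~R); rewrite D_mode // Dv linearZ_LR scalerBl.
have down j : exists c, D (xi_down j) = c *: xi_down j.
  by elim: j => [|j [c IH]] //=; apply: (sc _ _ _ c tF IH).
case: i => i; last exact: down.
by elim: i => [|i [c IH]] //=; apply: (sc _ _ _ c tE IH).
Qed.

Inductive heis_span : V -> Prop :=
  | heis_xi i : heis_span (vacuum_xi i)
  | heis_0 : heis_span 0
  | heis_lin b u v : heis_span u -> heis_span v -> heis_span (b *: u + v)
  | heis_mode p v : p < 0 -> heis_span v -> heis_span (H p v).

Lemma heis_scale b v : heis_span v -> heis_span (b *: v).
Proof. by move=> Sv; rewrite -[_ *: _]addr0; apply: heis_lin => //; exact: heis_0. Qed.

Lemma heis_add u v : heis_span u -> heis_span v -> heis_span (u + v).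
Proof. by move=> Su Sv; rewrite -[u]scale1r; apply: heis_lin. Qed.

Lemma heis_H n v : heis_span v -> heis_span (H n v).
Proof.
have [n0 ? |n0] := ltrP n 0; first exact: heis_mode.
elim=> {v} [i||b u v _ IHu _ IHv|p v p0 Sv IH].
- have [h0 hpos] := xi_vacuum i.
  have [n1|n1|<-] := ltrgtP 0 n; last by rewrite /Hmode h0; exact/heis_scale/heis_xi.
    by rewrite /Hmode hpos //; exact: heis_0.
  by move: n0; rewrite leNgt n1.
- by rewrite /Hmode linear0; exact: heis_0.
- by rewrite /Hmode linearP; exact: heis_lin.
- rewrite /Hmode (mode_hh (sl2_tripleEFH R)); apply: heis_add; last exact: heis_scale.
  exact: heis_mode.
Qed.

Lemma heis_E n v : heis_span v -> heis_span (E n v).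
Proof.
move=> Sv; elim: Sv n => {v} [i||b u v _ IHu _ IHv|p v p0 Sv IH] n.
- apply: (vacuum_closed (TripleEFH R) (xi_vacuum i)).
  + exact: heis_0.
  + exact: heis_lin.
  + exact: heis_mode.
  + by rewrite E_xi; exact: heis_xi.
- by rewrite linear0; exact: heis_0.
- by rewrite linearP; exact: heis_lin.
- rewrite (mode_eh (TripleEFH R)) -scaleN1r addrC.
  by apply: heis_lin => //; exact: heis_mode.
Qed.

Lemma heis_F n v : heis_span v -> heis_span (F n v).
Proof.
move=> Sv; elim: Sv n => {v} [i||b u v _ IHu _ IHv|p v p0 Sv IH] n.
- apply: (vacuum_closed (TripleFEH R) (vacuum_opp tH (xi_vacuum i))).
  + exact: heis_0.
  + exact: heis_lin.
  + move=> p u p0 Su; rewrite modeN // -scaleN1r; exact/heis_scale/heis_mode.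
  + by rewrite opprK F_xi; exact: heis_xi.
- by rewrite linear0; exact: heis_0.
- by rewrite linearP; exact: heis_lin.
- have -> : F n (H p v) = F (p + n) v + H p (F n v).
    by rewrite /Hmode (mode_hf (sl2_tripleEFH R)) addrC subrK.
  by apply: heis_add => //; exact: heis_mode.
Qed.

Lemma heis_span_all v : heis_span v.
Proof.
apply: (irreducible_ind irr (TripleEFH R)) v.
- exact: heis_0.
- by move=> b u v; exact: heis_lin.
- by move=> n v; exact: heis_E.
- by move=> n v; exact: heis_F.
- by move=> n v; exact: heis_H.
- move=> v; elim=> {v} [i||b u v _ IHu _ IHv|p v p0 Sv IH].
  + by have [c ->] := D_xi i; exact/heis_scale/heis_xi.
  + by rewrite linear0; exact: heis_0.
  + by rewrite linearP; exact: heis_lin.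
  + by rewrite D_mode // -scaleNr addrC; apply: heis_lin; exact: heis_mode.
- by exists xi0 => //; exact: (heis_xi 0).
Qed.

(** After removing the projection on [vacuum_xi i], the rest [y] is orthogonal to the other
    [vacuum_xi k] by weight and to all images of H(p), p < 0, since the adjoint H(-p) kills it. By
    [heis_span_all] it is zero. *)
Lemma vacuum_unique i v : vacuum (sl2H R) ((xi_weight i)%:~R / 2) v ->
  exists c, v = c *: vacuum_xi i.
Proof.
move=> vac; set x := vacuum_xi i; set c := pe_ip V v x / pe_ip V x x.
have [x0 xpos] := xi_vacuum i.
exists c; apply/subr0_eq; set y := v - _.
have y0 : H 0 y = ((xi_weight i)%:~R / 2) *: y.
  rewrite /Hmode linearB linearZ_LR /= vac.1 x0; vring.
have ypos n : 0 < n -> H n y = 0.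
  by move=> n0; rewrite /Hmode linearB linearZ_LR /= vac.2 ?xpos // scaler0 subr0.
have xy : pe_ip V x y = 0.
  apply: ip_eq0C; rewrite ipDl ipNl ipZl /c divfK ?subrr //.
  by rewrite gt_eqF // ip_gt0 // xi_neq0.
apply: ip_eq0; suff: forall w, heis_span w -> pe_ip V w y = 0.
  by apply; exact: heis_span_all.
move=> w; elim=> {w} [k||b u w _ IHu _ IHw|p w p0 Sw IH].
- have [->|ki] := eqVneq k i; first by [].
  have := H_adj 0 (vacuum_xi k) y; rewrite oppr0 y0 /Hmode (xi_vacuum k).1 ipZl linearZr_LR /=.
  rewrite fmorph_div rmorph_int rmorph_nat => /eqP; rewrite -subr_eq0 -mulrBl -mulrBl.
  rewrite !mulf_eq0 invr_eq0 pnatr_eq0 -intrB intr_eq0 orbF => /orP [|/eqP //].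
  by rewrite /xi_weight; lia.
- by rewrite ip0l.
- by rewrite ipDl ipZl IHu IHw mulr0 addr0.
- by rewrite H_adj ypos ?oppr_gt0 // ip0r.
Qed.

End VacuumLine.
End Vacuum.

(** * Virasoro operators and Goldstone vectors *)

Lemma isum_pos (K : nzRingType) (U : lmodType K) (M : nat) (f : int -> U) :
  (forall p : int, p <= 0 -> f p = 0) -> (forall p : int, M%:Z < p -> f p = 0) ->
  isum f = \sum_(i < M) f i.+1%:Z.
Proof.
move=> f0 fM; rewrite /isum (fsbigE [seq i.+1%:Z | i <- iota 0 M]).
- rewrite big_map -(big_mkord xpredT (fun i => f i.+1%:Z)) /index_iota subn0.
  by apply: eq_bigl => i; apply/mem_set.
- by rewrite map_inj_uniq ?iota_uniq // => x y [].
- by [].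
- move=> p _ /mapP pr; have [p0|p0] := lerP p 0; first exact: f0.
  apply: fM; rewrite ltNge; apply/negP => pM; apply: pr.
  by exists `|p|.-1%N; rewrite ?mem_iota; lia.
Qed.

Lemma isum_neg (K : nzRingType) (U : lmodType K) (M : nat) (f : int -> U) :
  (forall p : int, 0 <= p -> f p = 0) -> (forall p : int, p < - M%:Z -> f p = 0) ->
  isum f = \sum_(i < M) f (- i.+1%:Z).
Proof.
move=> f0 fM; rewrite -(isum_rev 0) (@isum_pos _ _ M) => [|p p0|p pM].
- by apply: eq_bigr => i _; rewrite sub0r.
- by apply: f0; lia.
- by apply: fM; lia.
Qed.

Section VirasoroModes.
Local Open Scope complex_scope.
Variables (R : realType) (V : level_one_rep R).
Local Notation K := R[i].
Local Notation D := (pe_D V).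
Local Notation H := (Hmode V).
Local Notation L := (virasoro V).
Implicit Types (u v w xi : V) (m n p : int).
Let T := sl2_tripleEFH R.

Lemma HD n u v : H n (u + v) = H n u + H n v.
Proof. exact: linearD. Qed.
Lemma HN n v : H n (- v) = - H n v.
Proof. exact: linearN. Qed.
Lemma HZ n a v : H n (a *: v) = a *: H n v.
Proof. exact: linearZ_LR. Qed.
Lemma H00 n : H n 0 = 0.
Proof. exact: linear0. Qed.
Lemma H_sum n (I : Type) (r : seq I) (P : pred I) (F : I -> V) :
  H n (\sum_(i <- r | P i) F i) = \sum_(i <- r | P i) H n (F i).
Proof. exact: linear_sum. Qed.
Lemma H_isum n (f : int -> V) : fin_supp f -> H n (isum f) = isum (fun p => H n (f p)).
Proof. by move=> ff; exact: (isum_map (pe_mode V (sl2H R) n) ff).1. Qed.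
Lemma H_fin n (f : int -> V) : fin_supp f -> fin_supp (fun p => H n (f p)).
Proof. by move=> ff; exact: (isum_map (pe_mode V (sl2H R) n) ff).2. Qed.

Lemma HC m n v : H m (H n v) = H n (H m v) + (m%:~R / 2 * (m + n == 0)%:R) *: v.
Proof. exact: mode_hh T m n v. Qed.

Lemma HC0 m n v : m + n != 0 -> H m (H n v) = H n (H m v).
Proof. by move=> /negPf mn; rewrite HC mn mulr0 scale0r addr0. Qed.

Lemma HH_fin n v : n != 0 -> fin_supp (fun p => H p (H (n - p) v)).
Proof.
move=> n0; have [N vN] := mode_vanish v; exists (N + `|n|)%N => p pN.
have [p0|p0] := ltrP p 0; first by rewrite /Hmode (vN _ T.(trh)) ?linear0 //; lia.
have -> : H p (H (n - p) v) = H (n - p) (H p v) by apply: HC0; lia.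
by rewrite /Hmode (vN _ T.(trh) p) ?linear0 //; lia.
Qed.

Lemma virasoroE n v : n != 0 -> L n v = isum (fun p => H p (H (n - p) v)).
Proof. by rewrite /virasoro => /negPf ->. Qed.

Lemma HH0_fin v : fin_supp (fun p => H (- `|p|) (H `|p| v)).
Proof.
have [N vN] := mode_vanish v; exists N => p pN.
by rewrite /Hmode (vN _ T.(trh) `|p|) ?linear0 //; lia.
Qed.

Lemma virasoro0E v : L 0 v = isum (fun p => H (- `|p|) (H `|p| v)).
Proof.
rewrite isum_even; [|exact: HH0_fin|by move=> p; rewrite normrN].
rewrite /virasoro eqxx normr0 oppr0; congr (_ + _ *: _).
by apply: eq_fsbigr => p; rewrite inE /= => p0; rewrite gtr0_norm.
Qed.

Lemma virasoro_lin n a u v : L n (a *: u + v) = a *: L n u + L n v.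
Proof.
have [->|n0] := eqVneq n 0.
  rewrite !virasoro0E -isumZ; last exact: HH0_fin.
  rewrite -isumD; [|exact/fin_suppZ/HH0_fin|exact: HH0_fin].
  by apply: eq_isum => p; rewrite /Hmode !linearP.
rewrite !virasoroE // -isumZ; last exact: HH_fin.
rewrite -isumD; [|exact/fin_suppZ/HH_fin|exact: HH_fin].
by apply: eq_isum => p; rewrite /Hmode !linearP.
Qed.

Lemma virasoro0r n : L n 0 = 0.
Proof.
by have := virasoro_lin n (-1) 0 0; rewrite scaler0 addr0 scaleN1r addNr.
Qed.

Lemma virasoroZ n a v : L n (a *: v) = a *: L n v.
Proof. by rewrite -[a *: v]addr0 virasoro_lin virasoro0r addr0. Qed.

Lemma virasoroN n v : L n (- v) = - L n v.
Proof. by rewrite -scaleN1r virasoroZ scaleN1r. Qed.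

Lemma virasoro_sum n (I : Type) (r : seq I) (P : pred I) (F : I -> V) :
  L n (\sum_(i <- r | P i) F i) = \sum_(i <- r | P i) L n (F i).
Proof.
apply: (big_morph (L n)) => [u v|]; last exact: virasoro0r.
by rewrite -[u]scale1r virasoro_lin !scale1r.
Qed.

Lemma virasoro_H n m v : 0 <= n -> 0 < m ->
  L n (H m v) = H m (L n v) - m%:~R *: H (n + m) v.
Proof.
(* Only the terms [p = n + m] and [p = - m] meet H(m) in a central term. Each contributes one half,
   the trace of H^2 being 1/2. *)
move=> n0 m0; pose c : V := (- m%:~R / 2) *: H (n + m) v.
pose f p w := if n == 0 then H (- `|p|) (H `|p| w) else H p (H (n - p) w).
have fE w : L n w = isum (f^~ w).
  by rewrite /f; case: eqVneq => [->|]; [exact: virasoro0E | exact: virasoroE].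
have ff w : fin_supp (f^~ w).
  by rewrite /f; case: eqVneq => [_|]; [exact: HH0_fin | exact: HH_fin].
have d1 := fin_supp_delta (n + m) c; have d2 := fin_supp_delta (- m) c.
have -> : - (m%:~R *: H (n + m) v)
    = isum (fun p => (p == n + m)%:R *: c + (p == - m)%:R *: c).
  by rewrite isumD // !isum_delta /c; apply: ip_ext => w; rewrite !(ipDl, ipNl, ipZl); field.
rewrite !fE H_isum // -isumD; [|exact: H_fin|exact: fin_suppD].
have delta p k w : ((p == k)%:R *: w : V) = if p == k then w else 0.
  by case: ifP => _; rewrite ?scale1r ?scale0r.
apply: eq_isum => p; rewrite !delta /f /c; case: eqVneq => [->|{}n0].
  rewrite !add0r [H `|p| _]HC0; last by lia.
  rewrite HC; congr (_ + _); have [->|pm] := eqVneq p m.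
    by rewrite gtr0_norm // addNr eqxx mulr1 rmorphN (_ : m == - m = false) ?addr0 //; lia.
  have [->|pm'] := eqVneq p (- m).
    by rewrite normrN gtr0_norm // addNr eqxx mulr1 rmorphN add0r.
  by rewrite (_ : (_ == 0) = false) ?mulr0 ?scale0r ?addr0 //; lia.
rewrite (HC (n - p)) HD HZ HC -addrA; congr (_ + _); rewrite addrC; congr (_ + _).
  have [->|pm] := eqVneq p (n + m).
    by rewrite (_ : n - (n + m) + m == 0) ?mulr1;
      [congr (_ / _ *: _); rewrite -rmorphN; congr (_%:~R)|]; lia.
  by rewrite (_ : (_ == 0) = false) ?mulr0 ?scale0r //; lia.
have [->|pm] := eqVneq p (- m).
  by rewrite addNr eqxx mulr1 rmorphN opprK.
by rewrite (_ : (_ == 0) = false) ?mulr0 ?scale0r //; lia.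
Qed.

(** The reflection [p -> n.+1 - p] identifies the terms of negative [p] with those beyond [n.+1],
    since modes of non-zero total index commute. This isolates the creation modes H(-r). *)
Lemma virasoro_pos_expand (n M : nat) v : (forall m, M%:Z < m -> H m v = 0) ->
  L n.+1%:Z v = 2 *: H n.+1%:Z (H 0 v)
    + \sum_(p < n) H p.+1%:Z (H (n - p)%N%:Z v)
    + 2 *: \sum_(r < M) H (- r.+1%:Z) (H (n.+1 + r.+1)%N%:Z v).
Proof.
move=> vM; have [m mE] : exists m, m = n.+1%:Z by exists n.+1%:Z.
rewrite -mE; have m0 : 0 < m by rewrite mE.
pose A p : V := if p < 0 then H p (H (m - p) v) else 0.
pose B p : V := if (0 < p) && (p < m) then H p (H (m - p) v) else 0.
have pointwise p : H p (H (m - p) v) = (A p + A (m - p)) + (B p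
    + ((p == 0)%:R *: H m (H 0 v) + (p == m)%:R *: H m (H 0 v))).
  have delta k w : ((p == k)%:R *: w : V) = if p == k then w else 0.
    by case: ifP => _; rewrite ?scale1r ?scale0r.
  rewrite !delta /A /B subr_lt0 subKr; have [p0|p0|->] := ltrgtP p 0.
  - have -> : m < p = false by lia.
    have -> : (p == m) = false by lia.
    by rewrite !addr0.
  - have [pm|pm|->] := ltrgtP p m.
    + by rewrite !addr0 add0r.
    + rewrite !addr0 add0r HC0; [by []|lia].
    + by rewrite subrr !add0r.
  - have -> : m < 0 = false by lia.
    have -> : (0 == m) = false by lia.
    rewrite subr0 !add0r addr0 HC0; [by []|lia].
have low p : p < - M%:Z -> H (m - p) v = 0 by move=> pM; apply: vM; lia.
have Afin : fin_supp A.
  exists M => p pM; rewrite /A; case: ifP => // p0; rewrite low ?H00 //; lia.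
have A'fin : fin_supp (fun p => A (m - p)).
  case: Afin => N AN; exists (N + n.+1)%N => p pN; apply: AN; lia.
have Bfin : fin_supp B.
  by exists n.+1 => p pn; rewrite /B (_ : _ && _ = false) //; lia.
have d1 := fin_supp_delta 0 (H m (H 0 v)); have d2 := fin_supp_delta m (H m (H 0 v)).
rewrite virasoroE; last by lia.
rewrite (eq_isum pointwise) !isumD //; do ?[exact: fin_suppD | apply: fin_suppD => //].
rewrite isum_rev !isum_delta.
have -> : isum A = \sum_(r < M) H (- r.+1%:Z) (H (n.+1 + r.+1)%N%:Z v).
  rewrite (@isum_neg _ _ M) => [|p p0|p pM].
  - by apply: eq_bigr => r _; rewrite /A oppr_lt0 /= opprK mE PoszD.
  - by rewrite /A ltNge p0.
  - by rewrite /A; case: ifP => // _; rewrite low // H00.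
have -> : isum B = \sum_(p < n) H p.+1%:Z (H (n - p)%N%:Z v).
  rewrite (@isum_pos _ _ n) => [|p p0|p pn].
  - apply: eq_bigr => p _; have pn := ltn_ord p.
    by rewrite /B (_ : _ && _ = true); [congr (H _ (H _ v))|]; lia.
  - by rewrite /B ltNge p0.
  - by rewrite /B (_ : _ && _ = false) //; lia.
vring.
Qed.

Lemma virasoro0_expand (M : nat) v : (forall m, M%:Z < m -> H m v = 0) ->
  L 0 v = H 0 (H 0 v) + 2 *: \sum_(r < M) H (- r.+1%:Z) (H r.+1%:Z v).
Proof.
move=> vM; rewrite /virasoro eqxx; congr (_ + _ *: _).
rewrite (fsbigE [seq i.+1%:Z | i <- iota 0 M]).
- rewrite big_map -(big_mkord xpredT (fun i : nat => H (- i.+1%:Z) (H i.+1%:Z v))).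
  by rewrite /index_iota subn0; apply: eq_bigl => i; apply/mem_set.
- by rewrite map_inj_uniq ?iota_uniq // => x y [].
- by move=> p /= /mapP [i _ ->].
- move=> p /= p0 /mapP pr; rewrite vM ?H00 //.
  rewrite ltNge; apply/negP => pM; apply: pr.
  by exists `|p|.-1%N; rewrite ?mem_iota; lia.
Qed.

Lemma virasoro0_norm (M : nat) v : (forall m, M%:Z < m -> H m v = 0) ->
  pe_ip V (L 0 v) v = pe_ip V (H 0 v) (H 0 v)
    + 2 * \sum_(r < M) pe_ip V (H r.+1%:Z v) (H r.+1%:Z v).
Proof.
move=> vM; rewrite (virasoro0_expand vM) ipDl ipZl ip_suml H_adj oppr0.
by congr (_ + _ * _); apply: eq_bigr => r _; rewrite H_adj opprK.
Qed.

Lemma H_vanish v : exists M : nat, forall m, M%:Z <= m -> H m v = 0.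
Proof. by have [M vM] := mode_vanish v; exists M => m; apply: vM; exact: T.(trh). Qed.

Section RealWeight.
Variables (m : R) (l : K) (v : V).
Hypothesis wt : H 0 v = m%:C *: v.
Hypothesis L0 : L 0 v = l *: v.

(** Unitarity in usable form: the right side is a finite sum of squared norms, so its sign bounds
    [l] and its vanishing kills every H(n) v with n > 0. *)
Lemma virasoro0_eigen_norm : exists M : nat, (forall n, M%:Z < n -> H n v = 0) /\
  (l - (m ^+ 2)%:C) * pe_ip V v v
    = 2 * \sum_(r < M) pe_ip V (H r.+1%:Z v) (H r.+1%:Z v).
Proof.
have [M vM] := H_vanish v; have vM' n : M%:Z < n -> H n v = 0 by move/ltW/vM.
exists M; split=> //; have := virasoro0_norm vM'.
rewrite L0 wt !ipZl linearZr_LR /= => E.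
apply: (addrI (m%:C * (m%:C * pe_ip V v v))).
have mC : Num.conj m%:C = m%:C by apply: conj_Creal; apply/complex_realP; exists m.
rewrite [in LHS]mulrBl E mC expr2 rmorphM /=; ring.
Qed.

Lemma virasoro0_ge : v != 0 -> (m ^+ 2)%:C <= l.
Proof.
move=> /ip_gt0 vv; have [M [_ E]] := virasoro0_eigen_norm.
rewrite -subr_ge0 -(pmulr_lge0 _ vv) E mulr_ge0 // sumr_ge0 //.
Qed.

Lemma virasoro0_lowest n : l = (m ^+ 2)%:C -> 0 < n -> H n v = 0.
Proof.
move=> lm n0; have [M [vM]] := virasoro0_eigen_norm.
rewrite lm subrr mul0r => /esym/eqP; rewrite mulf_eq0 pnatr_eq0 /= => /eqP/psumr_eq0P E.
have [/vM //|nM] := ltrP M%:Z n.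
have nM' : (`|n|.-1 < M)%N by lia.
apply: ip_eq0; have := E (fun i _ => ip_ge0 _) (Ordinal nM') isT.
by rewrite /= (_ : `|n|.-1.+1%:Z = n) //; lia.
Qed.

End RealWeight.

Hypothesis null : forall e f h, std_triple e f h -> forall n v, he_sum e h n v = 0 :> V.
Local Notation F := (pe_mode V (sl2F R)).
Local Notation E := (pe_mode V (sl2E R)).

(** The commutator of F(0) with H(p) H(n - p) is the term of index [p] in the null sum for F. For
    [n = 0] and [p > 0] the normal ordering produces F(0) twice, with opposite signs. *)
Lemma virasoro_F0 n v : L n (F 0 v) = F 0 (L n v).
Proof.
have T' := sl2_triple_opp T.
have FH p w : F 0 (H p w) = H p (F 0 w) + F p w.
  by rewrite /Hmode (mode_hf T) addr0 subrK.
have HF p q w : H p (F q w) = F q (H p w) - F (p + q) w by rewrite /Hmode (mode_hf T).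
have hN p w : pe_mode V (- sl2H R) p w = - H p w by rewrite modeN ?T.(trh).
pose k p := H p (F (n - p) v) + F p (H (n - p) v).
have kN p : - k p = pe_mode V (- sl2H R) p (F (n - p) v) + F p (pe_mode V (- sl2H R) (n - p) v).
  by rewrite !hN linearN /= /k opprD.
have kfin : fin_supp k.
  have := fin_suppZ (-1) (he_fin (TripleFEH R) n v); apply: eq_fin_supp => p.
  by rewrite -kN scaleN1r opprK.
have k0 : isum k = 0.
  have := null (TripleFEH R) n v; rewrite /he_sum -(eq_isum kN).
  have -> : isum (fun p => - k p) = - isum k.
    by rewrite -scaleN1r -isumZ //; apply: eq_isum => p; rewrite scaleN1r.
  by move/eqP; rewrite oppr_eq0 => /eqP.
have F_isum (f : int -> V) : fin_supp f -> F 0 (isum f) = isum (fun p => F 0 (f p)).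
  by move=> ff; exact: (isum_map (pe_mode V (sl2F R) 0) ff).1.
have [n0|n0] := eqVneq n 0; last first.
  rewrite !virasoroE // F_isum; last exact: HH_fin.
  rewrite -[LHS]addr0 -k0 -isumD //; last exact: HH_fin.
  by apply: eq_isum => p; rewrite /k !FH HD; vring.
rewrite n0 !virasoro0E F_isum; last exact: HH0_fin.
rewrite -[LHS]addr0 -k0 -isumD //; last exact: HH0_fin.
apply: eq_isum => p; rewrite /k n0 sub0r !FH HD; have [p0|p0] := lerP p 0.
  by rewrite ler0_norm // opprK; vring.
by rewrite gtr0_norm // !HF subrr addNr; vring.
Qed.

Lemma vacuum_virasoro k xi n : vacuum (sl2H R) k xi -> 0 < n -> L n xi = 0.
Proof.
case: n => [[|n]|] // [x0 xpos] _; rewrite (@virasoro_pos_expand n 0) //.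
rewrite [H 0 _]x0 HZ [H _ xi]xpos // big_ord0 !scaler0 addr0 add0r big1 // => p _.
by rewrite [H (n - p)%N%:Z xi]xpos ?H00 //; have := ltn_ord p; lia.
Qed.

Lemma vacuum_virasoro0 k xi : vacuum (sl2H R) k xi -> L 0 xi = k ^+ 2 *: xi.
Proof.
move=> [x0 xpos]; rewrite (@virasoro0_expand 0) // big_ord0 scaler0 addr0.
by rewrite [H 0 xi]x0 HZ [H 0 xi]x0 scalerA.
Qed.

Lemma virasoro_iterF n (p : nat) v : L n (iter p (F 0) v) = iter p (F 0) (L n v).
Proof. by elim: p => //= p IH; rewrite virasoro_F0 IH. Qed.

Lemma iterF_weight k (p : nat) v : H 0 v = k *: v ->
  H 0 (iter p (F 0) v) = (k - p%:R) *: iter p (F 0) v.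
Proof.
move=> v0; elim: p => [|p IH] /=; first by rewrite subr0.
by rewrite /Hmode (mode_hf T) addr0 [md in F 0 md]IH; rewrite linearZ_LR /= mulrSr; vring.
Qed.

(** The highest weight computation for sl_2: [a >= 0] puts E(0) in the range of [vacuum_above], so
    E(0) kills [xi]. The factor vanishes first at [p = a]. *)
Lemma iterF_E (a : int) (p : nat) xi : 0 <= a -> vacuum (sl2H R) (a%:~R / 2) xi ->
  E 0 (iter p.+1 (F 0) xi) = (p.+1%:R * (a%:~R - p%:R)) *: iter p (F 0) xi.
Proof.
move=> a0 vac; elim: p => [|p IH].
  rewrite /= (mode_ef T) (vacuum_above null (TripleEFH R) vac); last by lia.
  rewrite linear0 mul0r scale0r !addr0 add0r [md in 2 *: md]vac.1 scalerA.
  by congr (_ *: _); field.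
rewrite [iter p.+2 _ _]/= -/(iter p.+1 (F 0) xi) (mode_ef T) IH mul0r scale0r !addr0.
have /= := iterF_weight p.+1 vac.1; rewrite /Hmode => ->.
rewrite linearZ_LR /= scalerA -scalerDl; congr (_ *: _).
by rewrite !mulrSr; field.
Qed.

Lemma iterF_neq0 (a : int) (p : nat) xi : p%:Z <= a -> vacuum (sl2H R) (a%:~R / 2) xi -> xi != 0 ->
  iter p (F 0) xi != 0.
Proof.
move=> pa vac xi0; elim: p pa => // p IH pa; apply/eqP => x0.
have a0 : 0 <= a by lia.
have := iterF_E p a0 vac; rewrite x0 linear0 => /esym/eqP.
rewrite scaler_eq0 mulf_eq0 pnatr_eq0 /= -[p%:R]/((p%:Z)%:~R) -intrB intr_eq0 => /orP [].
  by lia.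
by apply/negP/IH; lia.
Qed.

End VirasoroModes.

(** * Energies of singular vectors *)

Lemma sum_shift (U : zmodType) (k M : nat) (f g : nat -> U) :
  (forall j, (j + k < M)%N -> f (j + k)%N = g j) ->
  (forall j, (M <= j + k)%N -> g j = 0) ->
  \sum_(n < M | (k <= n)%N) f n = \sum_(j < M) g j.
Proof.
move=> fg g0; rewrite -(big_mkord (fun n => (k <= n)%N) f) -(big_mkord xpredT g).
have [Mk|kM] := leqP M k.
  rewrite big_nat_cond big1 => [|j]; last by lia.
  by rewrite big1 // => j _; apply: g0; lia.
rewrite (@big_cat_nat _ _ _ k) //=; last exact: ltnW.
rewrite [X in X + _ = _]big_nat_cond [X in X + _ = _]big1 ?add0r => [|j]; last by lia.
rewrite [RHS](@big_cat_nat _ _ _ (M - k)) //=; last exact: leq_subr.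
rewrite [X in _ = _ + X]big_nat_cond [X in _ = _ + X]big1 ?addr0 => [|j jM]; last first.
  by apply: g0; lia.
rewrite -[in LHS](add0n k) big_addn add0n big_nat_cond [RHS]big_nat_cond.
apply: eq_big => [j|j jM]; first by rewrite leq_addl.
by apply: fg; lia.
Qed.

Lemma triangular_sum (U : zmodType) (M : nat) (b : nat -> U) :
  (forall s, (M <= s)%N -> b s = 0) ->
  \sum_(n < M) \sum_(r < M) b (n + r)%N = \sum_(s < M) b s *+ s.+1.
Proof.
move=> bM; transitivity (\sum_(n < M) \sum_(s < M | (n <= s)%N) b s).
  apply: eq_bigr => n _; rewrite (@sum_shift _ n M b (fun r => b (n + r)%N)) // => j.
    by rewrite addnC.
  by move=> Mj; apply: bM; rewrite addnC.
rewrite (exchange_big_dep xpredT) //=; apply: eq_bigr => s _.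
rewrite (eq_bigl (fun n : 'I_M => (n < s.+1)%N)) // -(big_ord_widen M (fun=> b s)) //.
by rewrite sumr_const card_ord.
Qed.

Section SquareEnergy.
Local Open Scope complex_scope.
Variables (R : realType) (V : level_one_rep R).
Local Notation K := R[i].
Local Notation H := (Hmode V).
Local Notation L := (virasoro V).
Variables (mu l : K) (v : V).
Hypothesis v_neq0 : v != 0.
Hypothesis wt : H 0 v = mu *: v.
Hypothesis L0 : L 0 v = l *: v.
Hypothesis Lpos : forall n : int, 0 < n -> L n v = 0.

(* [shift_seq n] is [:: q_n; ...; q_0], where
   [\sum_i t^i q_i = exp (- \sum_(s > 0) t^s H(s) / s) v]. *)
Fixpoint shift_seq (n : nat) : seq V :=
  if n is n'.+1 then
    (- n%:R^-1 *: \sum_(s < n) H s.+1%:Z (nth 0 (shift_seq n') s)) :: shift_seq n'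
  else [:: v].

(** Extended by zero to negative indices, so that indices can be shifted freely in the identities
    below. *)
Definition shift_coef (i : int) : V :=
  if i is Posz n then head 0 (shift_seq n) else 0.
Local Notation Q := shift_coef.

Lemma nth_shift_seq n s : nth 0 (shift_seq n) s = Q (n%:Z - s%:Z).
Proof.
elim: n s => [|n IH] [|s] //.
- by rewrite /= nth_nil; case: s.
- by rewrite subr0.
- by rewrite [nth _ _ _]/= IH; congr (Q _); lia.
Qed.

Lemma shift_coef_neg (i : int) : i < 0 -> Q i = 0.
Proof. by case: i. Qed.

(** Coefficients of t q'(t) = - (\sum_(s > 0) t^s H(s)) q(t). *)
Lemma shift_coef_eq (n : nat) :
  n%:R *: Q n = - \sum_(s < n) H s.+1%:Z (Q (n%:Z - s.+1%:Z)).
Proof.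
case: n => [|n]; first by rewrite big_ord0 scale0r oppr0.
rewrite /= scalerA mulrN divff ?pnatr_eq0 // scaleN1r; congr (- _).
by apply: eq_bigr => s _; rewrite nth_shift_seq; congr (H _ (Q _)); lia.
Qed.

Lemma shift_coef_below (N : nat) : energy_below N v ->
  forall i : nat, energy_below (N - i) (Q i).
Proof.
move=> vN; elim/ltn_ind=> -[|i] IH; first by rewrite subn0.
have -> : Q i.+1 = (- i.+1%:R^-1) *: \sum_(s < i.+1) H s.+1%:Z (Q (i.+1%:Z - s.+1%:Z)).
  by rewrite -[LHS](scalerK (a := i.+1%:R)) ?pnatr_eq0 // shift_coef_eq scalerN scaleNr.
have z : energy_below (N - i.+1) (0 : V).
  by exists (fun=> 0); split=> [k|]; rewrite ?linear0 ?scaler0 // big1.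
rewrite -[_ *: _]addr0; apply: energy_below_linear => //.
elim/big_ind: _ => // [x y xb yb|s _].
  by rewrite -[x]scale1r; exact: energy_below_linear.
have lt : (i - s < i.+1)%N by lia.
have -> : i.+1%:Z - s.+1%:Z = (i - s)%N :> int by have := ltn_ord s; lia.
have := energy_below_mode s.+1 (sl2_tripleEFH R).(trh) (IH _ lt).
by apply: energy_below_leq; have := ltn_ord s; lia.
Qed.

Variable N : nat.
Hypothesis vN : energy_below N v.

Lemma H_shift_coef_vanish n (i : int) : N%:Z <= n -> H n (Q i) = 0.
Proof.
case: i => i Nn; last by rewrite shift_coef_neg // H00.
apply: energy_below_vanish (sl2_tripleEFH R).(trh) (shift_coef_below vN i) _; lia.
Qed.

Lemma shift_coef_vanish (i : nat) : (N <= i)%N -> Q i = 0.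
Proof.
by move=> Ni; have := shift_coef_below vN i; rewrite (eqP Ni); exact: energy_below0.
Qed.

(** The same equation with a range of summation independent of [i], as needed for exchanging
    sums. *)
Lemma shift_coef_rec (M : nat) (i : int) : (N <= M)%N ->
  i%:~R *: Q i = - \sum_(s < M) H s.+1%:Z (Q (i - s.+1%:Z)).
Proof.
move=> NM; case: i => i; last first.
  by rewrite shift_coef_neg // scaler0 big1 ?oppr0 // => s _; rewrite shift_coef_neg ?H00 //; lia.
rewrite -pmulrn shift_coef_eq; congr (- _).
pose G (s : nat) := H s.+1%:Z (Q (i%:Z - s.+1%:Z)).
have ext k : (k <= i + M)%N -> (forall s, (k <= s)%N -> G s = 0) ->
    \sum_(s < k) G s = \sum_(s < i + M) G s.
  move=> kM Gk; rewrite (big_ord_widen (i + M) G) // big_mkcond.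
  by apply: eq_bigr => s _; case: ltnP => // /Gk.
rewrite (ext i) ?(ext M) ?leq_addl ?leq_addr // => s ss; rewrite /G.
  by rewrite H_shift_coef_vanish //; lia.
by rewrite shift_coef_neg ?H00 //; lia.
Qed.

Lemma H0_shift_coef (i : int) : H 0 (Q i) = mu *: Q i.
Proof.
case: i => i; last by rewrite shift_coef_neg // H00 scaler0.
elim/ltn_ind: i => -[|i] IH //.
have i0 : i.+1%:R != 0 :> K by rewrite pnatr_eq0.
apply: (scalerI i0); rewrite -HZ shift_coef_eq HN H_sum scalerA mulrC -scalerA shift_coef_eq.
rewrite scalerN scaler_sumr; congr (- _); apply: eq_bigr => s _.
rewrite HC0 //; have -> : i.+1%:Z - s.+1%:Z = (i - s)%N :> int by have := ltn_ord s; lia.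
by rewrite IH ?HZ //; lia.
Qed.

Lemma L0_shift_coef (i : int) : L 0 (Q i) = (l - i%:~R) *: Q i.
Proof.
case: i => i; last by rewrite shift_coef_neg // virasoro0r scaler0.
elim/ltn_ind: i => -[|i] IH; first by rewrite L0 subr0.
have i0 : i.+1%:R != 0 :> K by rewrite pnatr_eq0.
apply: (scalerI i0); rewrite -virasoroZ shift_coef_eq virasoroN virasoro_sum.
rewrite scalerA mulrC -scalerA shift_coef_eq scalerN scaler_sumr; congr (- _).
apply: eq_bigr => s _; rewrite virasoro_H // add0r.
have -> : i.+1%:Z - s.+1%:Z = (i - s)%N :> int by have := ltn_ord s; lia.
rewrite IH ?HZ; last by lia.
rewrite -scalerBl; congr (_ *: _); rewrite -addrA -opprD -intrD; congr (_ - _%:~R).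
by have := ltn_ord s; lia.
Qed.

(** In generating form, L_n q(t) = \sum_(r > 0) t^r H(n + r) q(t) for n > 0: L_n kills [v], and its
    commutator with the exponent is a sum of positive modes, which commute with the exponential. *)
Lemma Lpos_shift_coef (n M : nat) (i : int) : (N <= M)%N ->
  L n.+1%:Z (Q i) = \sum_(r < M) H (n.+1 + r.+1)%N%:Z (Q (i - r.+1%:Z)).
Proof.
move=> NM; have [k] : exists k : nat, i < k%:Z by exists `|i|.+1; lia.
have neg j : j < 0 ->
    L n.+1%:Z (Q j) = \sum_(r < M) H (n.+1 + r.+1)%N%:Z (Q (j - r.+1%:Z)).
  move=> j0; rewrite shift_coef_neg // virasoro0r big1 // => r _.
  by rewrite shift_coef_neg ?H00 //; lia.
elim: k i => [|k IH] i ik; first exact: neg.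
have [{}ik|ki] := ltrP i k%:Z; first exact: IH.
have {ik ki} -> : i = k%:Z by lia.
case: k IH => [|k] IH.
  rewrite [Q 0]/= Lpos // big1 // => r _; rewrite shift_coef_neg ?H00 //; lia.
have k0 : k.+1%:~R != 0 :> K by rewrite intr_eq0.
apply: (scalerI k0); rewrite -virasoroZ (shift_coef_rec _ NM) virasoroN virasoro_sum.
have -> : \sum_(s < M) L n.+1%:Z (H s.+1%:Z (Q (k.+1%:Z - s.+1%:Z))) =
    \sum_(s < M) (\sum_(r < M) H s.+1%:Z (H (n.+1 + r.+1)%N%:Z (Q (k.+1%:Z - s.+1%:Z - r.+1%:Z)))
      - s.+1%:~R *: H (n.+1 + s.+1)%N%:Z (Q (k.+1%:Z - s.+1%:Z))).
  by apply: eq_bigr => s _; rewrite virasoro_H // IH ?H_sum //; lia.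
rewrite sumrB opprB addrC exchange_big /= -sumrN -big_split scaler_sumr /=.
apply: eq_bigr => r _.
have -> : k.+1%:~R = (k.+1%:Z - r.+1%:Z)%:~R + r.+1%:~R :> K.
  by rewrite -intrD; congr _%:~R; lia.
rewrite scalerDl -[(k.+1%:Z - r.+1%:Z)%:~R *: _]HZ (shift_coef_rec _ NM) HN H_sum; congr (- _ + _).
apply: eq_bigr => s _; rewrite HC0; last by lia.
by congr (H _ (H _ (Q _))); lia.
Qed.

(* Here [d] is the degree of [\sum_i t^i q_i], and the equation is obtained by computing in two
   ways the coefficient of [t^d] in [\sum_(n > 0) t^n L_n \sum_i t^i q_i]. *)
Lemma singular_energy_square : exists d : nat, l = (d%:R - mu) ^+ 2.
Proof.
have exQ : exists d : nat, Q d != 0 by exists 0%N.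
have bndQ (d : nat) : Q d != 0 -> (d <= N)%N.
  by rewrite leqNgt; apply: contra => Nd; rewrite shift_coef_vanish // ltnW.
case: (ex_maxnP exQ bndQ) => d Qd0 dmax; exists d.
have Qtop (i : int) : d%:Z < i -> Q i = 0.
  by case: i => // i di; apply/eqP; apply: contraLR di => /dmax; lia.
have [M ME] : exists M, M = N.*2.+1 by exists N.*2.+1.
have NM : (N <= M)%N by lia.
pose a (k : nat) := H k%:Z (Q (d%:Z - k%:Z)).
have a0 k : (N <= k)%N -> a k = 0 by move=> Nk; apply: H_shift_coef_vanish.
set u := Q d in Qd0.
have suma : \sum_(s < M) a s.+1 = - d%:R *: u.
  by rewrite scaleNr -[d%:R]/(d%:~R) /u (shift_coef_rec _ NM) opprK.
have SA : \sum_(n < M) L n.+1%:Z (Q (d%:Z - n.+1%:Z)) = \sum_(s < M) a s.+1 *+ s.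
  transitivity (\sum_(s < M) a s.+2 *+ s.+1).
    rewrite -(@triangular_sum _ M (fun s => a s.+2)) => [|s Ms]; last by apply: a0; lia.
    apply: eq_bigr => n _; rewrite (Lpos_shift_coef _ _ NM); apply: eq_bigr => r _.
    by rewrite /a; congr (H _ (Q _)); lia.
  transitivity (\sum_(s < M.+1) a s.+1 *+ s); first by rewrite [RHS]big_ord_recl mulr0n add0r.
  by rewrite big_ord_recr /= a0 ?mul0rn ?addr0 //; lia.
(* With A = \sum_(s > 0) t^s H(s), this is the coefficient of t^d in A (A q) = - A (t q'), so the
   recursion is applied twice. *)
have B2 : \sum_(n < M) \sum_(p < n) H p.+1%:Z (H (n - p)%N%:Z (Q (d%:Z - n.+1%:Z)))
    = (d%:R ^+ 2) *: u + \sum_(p < M) a p.+1 *+ p.+1.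
  pose c (n p : nat) := H p.+1%:Z (H (n - p)%N%:Z (Q (d%:Z - n.+1%:Z))).
  rewrite (eq_bigr (fun n : 'I_M => \sum_(p < M | (p < n)%N) c n p)); last first.
    by move=> n _; rewrite (big_ord_widen M (c n)) // ltnW.
  rewrite (exchange_big_dep xpredT) //=.
  rewrite (eq_bigr (fun p : 'I_M => (- d%:R) *: a p.+1 + a p.+1 *+ p.+1)); last first.
    move=> p _; pose g (j : nat) := H p.+1%:Z (H j.+1%:Z (Q (d%:Z - p.+1%:Z - j.+1%:Z))).
    rewrite (@sum_shift _ p.+1 M (c^~ p) g) => [|j jM|j jM]; last 2 first.
    - by rewrite /c /g; congr (H _ (H _ (Q _))); lia.
    - rewrite /g; have [Nj|jN] := leqP N j.+1.
        by rewrite H_shift_coef_vanish ?H00 //; lia.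
      by rewrite HC0 ?H_shift_coef_vanish ?H00 //; lia.
    rewrite /g -H_sum -[\sum_(j < M) _]opprK -(shift_coef_rec _ NM) HN HZ -/(a p.+1).
    by rewrite -scaleNr -[a _ *+ _]scaler_nat -scalerDl; congr (_ *: _); rewrite intrB opprB addrC.
  by rewrite big_split /= -scaler_sumr suma scalerA; congr (_ *: _ + _); ring.
(* The recursion at index [d + r.+1], beyond the degree: its left side is zero, and among the first
   [r.+1] terms only the one containing [u] survives. Here the choice of [d] matters. *)
have B3 (r : nat) : \sum_(n < M) H (n.+1 + r.+1)%N%:Z (Q (d%:Z - n.+1%:Z)) = - H r.+1%:Z u.
  have := shift_coef_rec (d%:Z + r.+1%:Z) (leq_trans NM (leq_addl r.+1 M)).
  rewrite Qtop ?scaler0; last by lia.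
  rewrite big_split_ord /= big_ord_recr /= big1 ?add0r => [|s _]; last first.
    by rewrite Qtop ?H00 //; have := ltn_ord s; lia.
  rewrite addrK -/u => /esym/eqP; rewrite oppr_eq0 addrC addr_eq0 => /eqP <-.
  by apply: eq_bigr => n _; congr (H _ (Q _)); lia.
have SB : \sum_(n < M) L n.+1%:Z (Q (d%:Z - n.+1%:Z))
    = (- 2 * mu * d%:R) *: u + ((d%:R ^+ 2) *: u + \sum_(p < M) a p.+1 *+ p.+1)
      - (l - d%:R - mu ^+ 2) *: u.
  rewrite -B2; have vM i m : M%:Z < m -> H m (Q i) = 0.
    by move=> Mm; apply: H_shift_coef_vanish; lia.
  under eq_bigr => n _ do rewrite (virasoro_pos_expand n (vM _)).
  rewrite !big_split /=.
  congr (_ + _ + _).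
    rewrite (eq_bigr (fun n : 'I_M => (2 * mu) *: a n.+1)) => [|n _].
      by rewrite -scaler_sumr suma scalerA; congr (_ *: _); ring.
    by rewrite H0_shift_coef HZ scalerA.
  rewrite -scaler_sumr exchange_big /=.
  rewrite (eq_bigr (fun r : 'I_M => - H (- r.+1%:Z) (H r.+1%:Z u))) => [|r _]; last first.
    by rewrite -H_sum B3 HN.
  (* The creation modes now appear only as \sum 2 H(-r) H(r) u, which is (L_0 - H(0)^2) u with
     eigenvalue l - d - mu^2. *)
  have := virasoro0_expand (vM d); rewrite L0_shift_coef -/u !H0_shift_coef HZ H0_shift_coef -/u.
  move/(canLR (addKr _)); rewrite sumrN scalerN => <-.
  by rewrite /u !scalerBl; vring.
have := SB; rewrite SA.
have -> : \sum_(p < M) a p.+1 *+ p.+1 = \sum_(s < M) a s.+1 *+ s - d%:R *: u.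
  rewrite -scaleNr -suma -big_split; apply: eq_bigr => s _ /=.
  by rewrite mulrSr.
(* The sum [S], which is not known explicitly, occurs on both sides and cancels. *)
set S := \sum_(s < M) _ => E; apply/eqP; rewrite eq_sym -subr_eq0; apply/eqP.
have : ((d%:R - mu) ^+ 2 - l) *: u = 0.
  by apply: (addrI S); rewrite addr0 [RHS]E; vring.
by move/eqP; rewrite scaler_eq0 (negPf Qd0) orbF => /eqP.
Qed.

End SquareEnergy.

(** * Uniqueness of singular vectors of given weight and energy *)

Lemma sum_set_nth (f : nat -> nat) (s : seq nat) (i y : nat) : (i < size s)%N ->
  (\sum_(x <- set_nth 0 s i y) f x + f (nth 0 s i) = \sum_(x <- s) f x + f y)%N.
Proof.
elim: s i => // x s IH [|i] /= si; rewrite !big_cons; first by lia.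
by have := IH i si; lia.
Qed.

Lemma all_set_nth (P : pred nat) (s : seq nat) (i y : nat) : (i < size s)%N ->
  all P s -> P y -> all P (set_nth 0%N s i y).
Proof.
elim: s i => // x s IH [|i] /= si /andP [Px Ps] Py; first by rewrite Py.
by rewrite Px IH.
Qed.

Section SingularUnique.
Local Open Scope complex_scope.
Variables (R : realType) (V : level_one_rep R).
Local Notation K := R[i].
Local Notation H := (Hmode V).
Local Notation L := (virasoro V).
Local Notation pos := (all (leq 1)).

Definition Hword (s : seq nat) (w : V) : V := foldr (fun k => H k%:Z) w s.

Lemma Hword_front a x b w : pos a -> (0 < x)%N ->
  Hword (a ++ x :: b) w = Hword (x :: a ++ b) w.
Proof.
move=> + x0; elim: a => //= y a IH /andP [y0 pa].
by rewrite IH //= HC0 //; lia.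
Qed.

Lemma Hword_lin s a u w : Hword s (a *: u + w) = a *: Hword s u + Hword s w.
Proof. by elim: s => //= k s ->; rewrite HD HZ. Qed.

Lemma Hword0 s : Hword s 0 = 0.
Proof. by elim: s => //= k s ->; rewrite H00. Qed.

Lemma Hword_virasoro s n w : pos s -> Hword s (L n%:Z w) = L n%:Z (Hword s w)
  + \sum_(i < size s) (nth 0%N s i)%:R *: Hword (set_nth 0%N s i (nth 0%N s i + n)%N) w.
Proof.
elim: s => [|x s IH] /=; first by rewrite big_ord0 addr0.
move=> /andP [x0 ps]; rewrite IH // big_ord_recl /= HD H_sum virasoro_H //.
rewrite [RHS]addrA [(x + n)%N]addnC PoszD subrK; congr (_ + _).
by apply: eq_bigr => i _; rewrite HZ.
Qed.

Lemma Hword_weight s w k : pos s -> H 0 w = k *: w -> H 0 (Hword s w) = k *: Hword s w.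
Proof.
move=> + w0; elim: s => //= x s IH /andP [x0 ps].
by rewrite HC0 ?IH ?HZ //; lia.
Qed.

Lemma Hword_energy s w l : pos s -> L 0 w = l *: w ->
  L 0 (Hword s w) = (l - (\sum_(x <- s) x)%N%:R) *: Hword s w.
Proof.
move=> + w0; elim: s => [|x s IH] /=; first by rewrite big_nil subr0.
move=> /andP [x0 ps]; rewrite virasoro_H // IH // HZ add0r big_cons natrD.
by rewrite -scalerBl -[x%:~R]/(x%:R); congr (_ *: _); ring.
Qed.

Variables (m : R) (N : nat).
Let l : K := (m ^+ 2)%:C + N%:R.
Definition primary v := [/\ H 0 v = m%:C *: v, L 0 v = l *: v
  & forall n : int, 0 < n -> L n v = 0].

Lemma primary_lin a u v : primary u -> primary v -> primary (a *: u + v).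
Proof.
move=> [u1 u2 u3] [v1 v2 v3]; split=> [||n n0].
- by rewrite HD HZ u1 v1; vring.
- by rewrite virasoro_lin u2 v2; vring.
- by rewrite virasoro_lin u3 // v3 // scaler0 addr0.
Qed.

Lemma primaryZ a u : primary u -> primary (a *: u).
Proof.
move=> pu; rewrite -[a *: u]addr0; apply: primary_lin => //.
by split=> [||n n0]; rewrite ?H00 ?virasoro0r ?scaler0.
Qed.

(** Such a word would lower the energy below m^2 while keeping the weight m, against
    [virasoro0_ge]. *)
Lemma Hword_above s v : primary v -> pos s -> (N < \sum_(x <- s) x)%N -> Hword s v = 0.
Proof.
move=> [v1 v2 _] ps Ns; have [//|w0] := eqVneq (Hword s v) 0.
have := virasoro0_ge (Hword_weight ps v1) (Hword_energy ps v2) w0.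
by rewrite /l -addrA -subr_ge0 addrAC subrr add0r subr_ge0 ler_nat leqNgt Ns.
Qed.

Lemma Hword_vacuum s v n : primary v -> pos s -> (\sum_(x <- s) x)%N = N -> 0 < n ->
  H n (Hword s v) = 0.
Proof.
move=> [v1 v2 _] ps Ns; apply: (virasoro0_lowest (Hword_weight ps v1) (Hword_energy ps v2)).
by rewrite Ns /l addrK.
Qed.

Lemma size_leq_sum s : pos s -> (size s <= \sum_(x <- s) x)%N.
Proof. by elim: s => //= x s IH /andP [x0 /IH]; rewrite big_cons; lia. Qed.

Lemma sumsq_leq (s : seq nat) : (\sum_(x <- s) x ^ 2 <= (\sum_(x <- s) x) ^ 2)%N.
Proof.
elim: s => [|x s IH]; rewrite ?big_nil // !big_cons.
by apply: leq_trans (leq_add (leqnn _) IH) _; rewrite sqrnD leq_addr.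
Qed.

(* Descending induction, on the number of letters first and on the sum of their squares next:
   [Hword (1 :: s) (L n v) = 0], expanded, expresses [Hword (n.+1 :: s) v] through
   words which are longer or have a larger sum of squares. *)
Lemma primary_eq0_words v : primary v -> iter N (H 1) v = 0 ->
  forall s, pos s -> (\sum_(x <- s) x)%N = N -> Hword s v = 0.
Proof.
move=> pv top; have [v1 v2 v3] := pv.
(* [C] exceeds every sum of squares in question, so [meas] encodes the lexicographic order in one
   number. *)
pose C := (N ^ 2).+1; pose meas s := (C * size s + \sum_(x <- s) x ^ 2)%N.
have measle s : pos s -> (\sum_(x <- s) x)%N = N -> (meas s <= C * N + N ^ 2)%N.
  move=> ps Ns; apply: leq_add; first by rewrite leq_mul2l -[X in (_ <= X)%N]Ns size_leq_sum ?orbT.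
  by rewrite -Ns sumsq_leq.
suff: forall k s, (C * N + N ^ 2 - meas s < k)%N -> pos s -> (\sum_(x <- s) x)%N = N ->
    Hword s v = 0 by move=> P s; apply: P (ltnSn _).
elim=> // k IH s sk ps Ns.
have {}IH t : pos t -> (\sum_(x <- t) x)%N = N -> (meas s < meas t)%N -> Hword t v = 0.
  by move=> pt Nt st; apply: IH => //; have := measle t pt Nt; lia.
have [/hasP [M Ms M2]|/hasPn ones] := boolP (has (leq 2) s); last first.
  have sE : s = nseq (size s) 1%N.
    by apply/all_pred1P/allP => x xs; have := ones x xs; have := allP ps x xs; rewrite /= ; lia.
  have sN : size s = N.
    by rewrite -Ns sE size_nseq big_nseq iter_addn_0 mul1n.
  rewrite sE sN -top; elim: (N) => //= j ->; done.
case: M M2 Ms => [|[|n]] // _ Ms; set M := n.+2.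
case/splitPr: Ms ps Ns sk IH => a b.
rewrite all_cat big_cat big_cons => /and3P [pa M0 pb] Ns _ IH.
rewrite (Hword_front _ _ pa M0); set c : seq nat := a ++ b.
have pc : pos c by rewrite all_cat pa.
have sumc : (M + \sum_(x <- c) x)%N = N by rewrite big_cat /= -Ns addnCA.
have measE : meas (a ++ M :: b) = (C * (size c).+1 + (M ^ 2 + \sum_(x <- c) x ^ 2))%N.
  by rewrite /meas /c !size_cat !big_cat big_cons /= addnS; lia.
clearbody c.
have IHlong t : pos t -> (\sum_(x <- t) x)%N = N -> ((size c).+1 < size t)%N -> Hword t v = 0.
  move=> pt Nt ct; apply: IH => //; rewrite measE.
  have := sumsq_leq (M :: c); rewrite !big_cons sumc => sq.
  apply: (@leq_trans (C * (size c).+2)%N).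
    by rewrite [(C * _.+2)%N]mulnS addnC ltn_add2r ltnS.
  by rewrite /meas; apply: leq_trans (leq_addr _ _); rewrite leq_mul2l ct orbT.
have p1c : pos (1%N :: c) by [].
set w := Hword (1%N :: c) v.
(* Terms of L that contain only non-negative modes give words with more letters than [M :: c]; those
   with a creation mode contain a word of degree above [N]. *)
have Lw : L n.+1%:Z w = 0.
  have above (j : nat) : (N < j + 1 + \sum_(x <- c) x)%N -> H j%:Z w = 0.
    move=> Nj; rewrite -[H _ _]/(Hword [:: j, 1%N & c] v) Hword_above //=.
      by rewrite pc andbT; lia.
    by rewrite !big_cons addnA.
  rewrite (@virasoro_pos_expand _ _ n N) => [|j Nj]; last first.
    by case: j Nj => // j Nj; apply: above; lia.
  rewrite (Hword_weight p1c v1) HZ.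
  rewrite -[H n.+1%:Z w]/(Hword [:: n.+1, 1%N & c] v) IHlong //; last first.
    by rewrite !big_cons; lia.
  rewrite scaler0 scaler0 add0r big1 ?add0r => [|p _]; last first.
    have pn := ltn_ord p.
    rewrite -[LHS]/(Hword [:: p.+1, (n - p)%N, 1%N & c] v) IHlong //=; first by rewrite subn_gt0 pn.
    by rewrite !big_cons; lia.
  by rewrite big1 ?scaler0 // => r _; rewrite above ?H00 //; lia.
have := Hword_virasoro n.+1 v p1c.
rewrite v3 // Hword0 Lw add0r big_ord_recl /= scale1r add1n -/M.
set t := H M%:Z _.
have tE : Hword (M :: c) v = t by [].
(* Raising a letter 1 of [c] by [n.+1] gives a permutation of [M :: c], hence [t] again. Raising
   [x >= 2] increases the sum of squares, as (x + n + 1)^2 + 1 > x^2 + (n + 2)^2. The total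
   coefficient of [t] is one plus the number of ones in [c], which is non-zero. *)
rewrite (eq_bigr (fun i : 'I_(size c) => (nth 0%N c i == 1%N)%:R *: t)) => [|i _]; last first.
  have ic := ltn_ord i; set x := nth 0%N c i.
  have x0 : (0 < x)%N by exact: (all_nthP 0%N pc).
  have [x1|x1] := eqVneq x 1%N.
    rewrite x1 !scale1r set_nthE ic add1n -/M.
    rewrite -[LHS]/(Hword ((1%N :: take i c) ++ M :: drop i.+1 c) v).
    have pt : pos (take i c) by apply/(all_nthP 0%N) => j; rewrite size_take ic => ji;
      rewrite nth_take //; apply: (all_nthP 0%N pc); exact: ltn_trans ji ic.
    rewrite Hword_front //= /t; congr (H _ _).
    by rewrite -[in RHS](cat_take_drop i c) (drop_nth 0%N ic) -/x x1 Hword_front.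
  have szc : size (set_nth 0%N c i (x + n.+1)) = size c.
    by rewrite size_set_nth; apply/maxn_idPr.
  have sum1 := @sum_set_nth id c i (x + n.+1) ic.
  have sum2 := @sum_set_nth (fun y => y ^ 2)%N c i (x + n.+1) ic.
  rewrite scale0r -[H _ _]/(Hword (1%N :: set_nth 0%N c i (x + n.+1)%N) v) IH ?scaler0 //.
  - by apply/andP; split=> //; apply: all_set_nth => //; rewrite addnS.
  - by move: sum1; rewrite big_cons -/x /=; lia.
  - rewrite measE /meas /= szc ltn_add2l big_cons.
    by move: sum2; rewrite -/x /M -!mulnn; nia.
rewrite -scaler_suml -{1}[t]scale1r -scalerDl -natr_sum -[1]/(1%:R) -natrD => /esym/eqP.
by rewrite scaler_eq0 pnatr_eq0 => /eqP.
Qed.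

(** Descending induction on the degree of words: once all words of larger degree vanish, a word of
    degree below [N] is killed by every H(n), n > 0. Its energy would then be m^2, but it is
    strictly larger. The empty word gives [v]. *)
Lemma primary_eq0 v : primary v -> iter N (H 1) v = 0 -> v = 0.
Proof.
move=> pv top; have [v1 v2 _] := pv.
suff: forall k s, pos s -> (N <= k + \sum_(x <- s) x)%N -> Hword s v = 0.
  by move=> /(_ N [::]); apply=> //; rewrite leq_addr.
elim=> [|k IH] s ps Ns.
  have [sN|sN|sN] := ltngtP (\sum_(x <- s) x)%N N; first by lia.
    exact: Hword_above.
  exact: primary_eq0_words.
have [sN|sN] := leqP N (k + \sum_(x <- s) x)%N; first exact: IH.
have vac : vacuum (sl2H R) m%:C (Hword s v).
  split; first exact: Hword_weight.
  case=> // -[//|j] _; apply: (IH (j.+1 :: s)) => //.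
  by rewrite big_cons; lia.
have := vacuum_virasoro0 vac; rewrite (Hword_energy ps v2) /l rmorphXn /=.
move/eqP; rewrite -subr_eq0 -scalerBl scaler_eq0 => /orP [|/eqP //].
by rewrite addrAC [_ + N%:R]addrC addrK subr_eq0 eqr_nat => /eqP NE; lia.
Qed.

Hypothesis vac1 : forall x y : V, vacuum (sl2H R) m%:C x -> x != 0 ->
  vacuum (sl2H R) m%:C y -> exists c, y = c *: x.

Lemma primary_unique u v : primary u -> u != 0 -> primary v -> exists c, v = c *: u.
Proof.
move=> pu u0 pv.
have nseqE w : iter N (H 1) w = Hword (nseq N 1%N) w by elim: (N) => //= j ->.
have p1 : pos (nseq N 1%N) by rewrite all_nseq orbT.
have s1 : (\sum_(x <- nseq N 1%N) x)%N = N by rewrite big_nseq iter_addn_0 mul1n.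
have vac w : primary w -> vacuum (sl2H R) m%:C (iter N (H 1) w).
  move=> pw; rewrite nseqE; split; last by move=> n; exact: Hword_vacuum.
  by have [w1 _ _] := pw; exact: Hword_weight.
have top0 : iter N (H 1) u != 0.
  by apply: contraNN u0 => /eqP/(primary_eq0 pu) ->.
have [c vE] := vac1 (vac u pu) top0 (vac v pv).
exists c; apply/esym/subr0_eq; rewrite -[- v]scaleN1r addrC.
apply: primary_eq0.
  exact/primary_lin/primaryZ.
by rewrite nseqE Hword_lin -[c *: u]addr0 Hword_lin Hword0 addr0 -!nseqE vE scaleN1r addNr.
Qed.

End SingularUnique.

(** * The lowest energy space *)

Section LowestEnergy.
Variables (R : realType) (V : level_one_rep R).
Local Notation K := R[i].
Local Notation md := (pe_mode V).

(** Being a commutator with [b], both [b] and [b *m b] have trace zero; in dimension at most two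
    this forces b^2 = 0. *)
Lemma commutator_nilpotent d (a b : 'M[K]_d) : (d == 1%N) || (d == 2%N) ->
  b = lie_bracket a b -> b *m b = 0.
Proof.
have tr0 n (x y : 'M[K]_n) : y = lie_bracket x y -> \tr y = 0 /\ \tr (y *m y) = 0.
  move=> yE; split; first by rewrite yE /lie_bracket linearB /= mxtrace_mulC subrr.
  have cyc : \tr (y *m x *m y) = \tr (x *m y *m y).
    by rewrite mxtrace_mulC mulmxA mxtrace_mulC mulmxA.
  by rewrite {1}yE /lie_bracket mulmxBl linearB /= cyc subrr.
case/orP => /eqP dE; subst d => bE; have [tb tbb] := tr0 _ _ _ bE.
  apply/matrixP => i j; rewrite !ord1 mxE big_ord1 mxE.
  by move: tb; rewrite /mxtrace big_ord1 => ->; rewrite mul0r.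
move: tb tbb; rewrite !mxtrace2 => /eqP; rewrite addr_eq0 => /eqP b00.
rewrite !mxE !big_ord_recl !big_ord0 /= => tbb.
have o1 : lift ord0 ord0 = 1 :> 'I_2 by apply/val_inj.
move: tbb; rewrite !o1 b00 => tbb.
have bb : b 1 1 ^+ 2 + b 0 1 * b 1 0 = 0.
  apply: (mulfI (x := 2)); first by rewrite pnatr_eq0.
  by rewrite mulr0 -[RHS]tbb; ring.
apply/matrixP => i j; rewrite !mxE !big_ord_recl !big_ord0 /= !o1 addr0.
case: (ord2P i) => ->; case: (ord2P j) => ->; rewrite ?b00.
- by rewrite -[RHS]bb; ring.
- by ring.
- by ring.
- by rewrite -[RHS]bb; ring.
Qed.

Variable j : R.
Hypothesis hj : j = 0 \/ j = 2^-1.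
Hypothesis hV0 : lowest_energy_spin V j.

Lemma grade0_mode X v : \tr X = 0 -> v \in pe_grade V 0 -> md X 0 v \in pe_grade V 0.
Proof.
case: hV0 => d [rho [phi [_ _ _ g0 com]]] tX /g0 [w ->].
by rewrite -com //; apply/g0; exists (rho X *m w).
Qed.

Lemma grade0_nonzero : exists2 v, v != 0 & v \in pe_grade V 0.
Proof.
case: hV0 => d [rho [phi [_ [_ _ [[w w0] _]] inj g0 com]]].
exists (phi w); last by apply/g0; exists w.
by apply: contraNN w0 => /eqP pw; apply/eqP/inj; rewrite pw linear0.
Qed.

Lemma grade0_sq0 e f h v : std_triple e f h -> v \in pe_grade V 0 -> md e 0 (md e 0 v) = 0.
Proof.
move=> /std_triple_sl2 T.
case: hV0 => d [rho [phi [dj [_ lie _] inj g0 com]]] /g0 [w ->].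
have d12 : (d == 1%N) || (d == 2%N).
  rewrite -(eqr_nat R) -(eqr_nat R d) dj; case: hj => ->.
    by rewrite mulr0 add0r eqxx.
  by rewrite divff ?pnatr_eq0 // eqxx orbT.
rewrite -!com ?T.(tre) // mulmxA (@commutator_nilpotent _ (rho h)) ?mul0mx ?linear0 //.
by rewrite -lie ?T.(trh) ?T.(tre) // T.(lihe).
Qed.

(** Expanding E(0)^2 F(0) y = 0 gives (H E + E H) y = 0, which with [H, E] = E determines the weight
    of E y. *)
Lemma grade0_E_weight y : y \in pe_grade V 0 ->
  md (sl2H R) 0 (md (sl2E R) 0 y) = 2^-1 *: md (sl2E R) 0 y.
Proof.
move=> yg; have T := sl2_tripleEFH R.
have sq w : w \in pe_grade V 0 -> md (sl2E R) 0 (md (sl2E R) 0 w) = 0.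
  exact: grade0_sq0 (TripleEFH R).
have := sq _ (grade0_mode T.(trf) yg).
rewrite (mode_ef T) mul0r scale0r addr0 linearD /= (mode_ef T) sq // linear0 add0r.
rewrite mul0r scale0r addr0 linearZ_LR /= addr0 => E2.
have := mode_he T 0 0 y; rewrite addr0 => HE.
apply: (scalerI (a := 4)); first by rewrite pnatr_eq0.
rewrite -[RHS]addr0 -E2 HE.
by apply: ip_ext => x; rewrite !(ipDl, ipZl); field.
Qed.

(** Otherwise the brackets make H and F vanish too, and any line in the two-dimensional space, here
    [W], contradicts irreducibility. *)
Lemma grade0_E_neq0 : j = 2^-1 -> exists2 y, y \in pe_grade V 0 & md (sl2E R) 0 y != 0.
Proof.
move=> jE; have T := sl2_tripleEFH R; have [tE tF tH] := And3 T.(tre) T.(trf) T.(trh).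
apply: contrapT => noE.
have E0 y : y \in pe_grade V 0 -> md (sl2E R) 0 y = 0.
  by move=> yg; have [//|Ey] := eqVneq (md (sl2E R) 0 y) 0; case: noE; exists y.
have H0 y : y \in pe_grade V 0 -> md (sl2H R) 0 y = 0.
  move=> yg; have := mode_ef T 0 0 y; rewrite !E0 ?grade0_mode // linear0 add0r mul0r scale0r.
  by rewrite !addr0 => /esym/eqP; rewrite scaler_eq0 pnatr_eq0 => /eqP.
have F0 y : y \in pe_grade V 0 -> md (sl2F R) 0 y = 0.
  move=> yg; have := mode_hf T 0 0 y; rewrite !H0 ?grade0_mode // linear0 sub0r addr0.
  by move/esym/eqP; rewrite oppr_eq0 => /eqP.
case: hV0 => d [rho [phi [dj [_ _ [_ irr]] inj g0 com]]].
have d2 : d = 2%N by apply/eqP; rewrite -(eqr_nat R) dj jE divff ?pnatr_eq0.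
subst d; pose W : {pred 'cV[K]_2} := fun w => w 0 0 == 0.
have rho0 X (w : 'cV_2) : \tr X = 0 -> rho X *m w = 0.
  move=> tX; apply: inj; rewrite linear0 com //.
  have pg : phi w \in pe_grade V 0 by apply/g0; exists w.
  exact: (mode_std_eq0 (TripleEFH R) (E0 _ pg) (F0 _ pg) (H0 _ pg)).
case: (irr W) => [|f [X tX ->] w _|W0|W1].
- split=> [|a u w]; first by rewrite unfold_in mxE.
  by rewrite !unfold_in => /eqP u0 /eqP w0; rewrite !mxE u0 w0 mulr0 addr0.
- by rewrite rho0 // unfold_in mxE.
- have inW : delta_mx 1 0 \in W by rewrite unfold_in mxE.
  by have /matrixP /(_ 1 0) /eqP := W0 _ inW; rewrite !mxE /= oner_eq0.
- by have := W1 (delta_mx 0 0); rewrite unfold_in mxE /= oner_eq0.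
Qed.

Lemma grade0_H0 v : j = 0 -> v \in pe_grade V 0 -> md (sl2H R) 0 v = 0.
Proof.
move=> jE; have T := sl2_tripleEFH R; have [tE tF tH] := And3 T.(tre) T.(trf) T.(trh).
case: hV0 => d [rho [phi [dj [_ lie _] inj g0 com]]] /g0 [w ->].
have d1 : d = 1%N by apply/eqP; rewrite -(eqr_nat R) dj jE mulr0 add0r.
subst d; have := com (2 *: sl2H R) w; rewrite -T.(lief) lie //.
have -> : lie_bracket (rho (sl2E R)) (rho (sl2F R)) = 0.
  by apply/matrixP => i k; rewrite !ord1 !mxE !big_ord1 mulrC subrr.
rewrite mul0mx linear0 T.(lief) (modeZ _ 0 (phi w) tH) => H2.
have tH2 : \tr (2 *: sl2H R) = 0 by rewrite linearZ /= tH mulr0.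
have /esym/eqP := H2 tH2.
by rewrite scaler_eq0 pnatr_eq0 => /eqP.
Qed.

Lemma grade0_weight : exists (a : int) (v : V), [/\ j = a%:~R / 2, v != 0,
  v \in pe_grade V 0 & md (sl2H R) 0 v = (a%:~R / 2) *: v].
Proof.
have [j0|j2] := hj.
  have [v v0 vg] := grade0_nonzero; exists 0, v; split=> //; first by rewrite j0 mul0r.
  by rewrite grade0_H0 // mul0r scale0r.
have [y yg Ey] := grade0_E_neq0 j2; exists 1, (md (sl2E R) 0 y); split=> //.
- by rewrite j2 mul1r.
- exact: grade0_mode (sl2_tripleEFH R).(tre) yg.
- by rewrite mul1r grade0_E_weight.
Qed.

End LowestEnergy.

(** * Goldstone vectors, and their comparison with singular vectors *)

Section Goldstone.
Local Open Scope complex_scope.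
Variables (R : realType) (V : level_one_rep R) (j : R).
Local Notation K := R[i].
Local Notation F := (pe_mode V (sl2F R)).
Hypothesis irr : irreducible_rep V.
Hypothesis hj : j = 0 \/ j = 2^-1.
Hypothesis hV0 : lowest_energy_spin V j.

Lemma he_sum_null e f h : std_triple e f h -> forall n v, he_sum e h n v = 0 :> V.
Proof.
move=> std n v; apply: (he_sum_eq0 irr _ _ std).
- by move=> X w; exact: (grade0_mode hV0).
- exact: (grade0_nonzero hV0).
- by move=> w; exact: (grade0_sq0 hj hV0 std).
Qed.

Lemma vacuum_line : exists a : int, j = a%:~R / 2 /\ forall b : int, exists x : V,
  [/\ x != 0, vacuum (sl2H R) ((a + 2 * b)%:~R / 2) x
    & forall y, vacuum (sl2H R) ((a + 2 * b)%:~R / 2) y -> exists c, y = c *: x].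
Proof.
have [a [x0 [ja x00 x0g x0w]]] := grade0_weight hj hV0; exists a; split=> // b.
have vac0 : vacuum (sl2H R) (a%:~R / 2) x0.
  split=> // n n0; apply: mode_pos_grade0 => //; exact: (sl2_tripleEFH R).(trh).
have D0 : exists c, pe_D V x0 = c *: x0 by exists 0; rewrite scale0r D_grade0.
exists (vacuum_xi a x0 b); split.
- exact: (xi_neq0 he_sum_null x00 vac0).
- exact: (xi_vacuum he_sum_null x00 vac0 b).
- move=> y; exact: (vacuum_unique he_sum_null irr x00 vac0 D0).
Qed.

Lemma half_intC (z : int) : (z%:~R / 2)%:C = z%:~R / 2 :> K.
Proof. by rewrite fmorph_div rmorph_int rmorph_nat. Qed.

Variable (z : int).
Let m : R := z%:~R / 2.

Lemma goldstone_half g : goldstone V m g -> exists (r p : nat) (xi : V),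
  [/\ (`|z| + r.*2)%N%:Z = z + 2 * p%:Z, vacuum (sl2H R) ((`|z| + r.*2)%N%:~R / 2) xi,
      xi != 0 & g = iter p (F 0) xi].
Proof.
case=> k [r [p [xi [kE pE [xi0 wt pos] gE]]]]; exists r, p, xi.
have absm : `|m| = `|z|%:~R / 2.
  by rewrite normrM intr_norm normfV (ger0_norm (_ : 0 <= 2)).
have k2 : k = (`|z| + r.*2)%N%:~R / 2.
  by rewrite kE absm PoszD intrD -mul2n PoszM intrM abszE; field.
split=> //; last by split=> //; rewrite -half_intC -k2.
have : (k - m) * 2 = p%:R * 2 by rewrite pE.
rewrite k2 /m mulrBl !divfK ?pnatr_eq0 // => /eqP.
rewrite -[p%:R]/(p%:~R) -[2]/(2%:~R) -intrM -intrB eqr_int => /eqP; lia.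
Qed.

(** With k = (|z| + 2 r) / 2 and m = z / 2, the excess energy k^2 - m^2 is r (|z| + r), and [p] is k
    - m. *)
Lemma iterF_primary (r p : nat) (xi : V) : (`|z| + r.*2)%N%:Z = z + 2 * p%:Z ->
  vacuum (sl2H R) ((`|z| + r.*2)%N%:~R / 2) xi -> xi != 0 ->
  iter p (F 0) xi != 0 /\ primary m (r * (`|z| + r)) (iter p (F 0) xi).
Proof.
move=> rp vac xi0.
have mE : m%:C = (`|z| + r.*2)%N%:~R / 2 - p%:R :> K.
  have -> : (`|z| + r.*2)%N%:~R = (z + 2 * p%:Z)%:~R :> K by rewrite rp.
  by rewrite half_intC intrD intrM; field.
split; first by apply: (iterF_neq0 he_sum_null _ vac xi0); lia.
split.
- by rewrite mE; apply: iterF_weight; exact: vac.1.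
- rewrite (virasoro_iterF he_sum_null) (vacuum_virasoro0 vac).
  have iterZ c w : iter p (F 0) (c *: w) = c *: iter p (F 0) w.
    by elim: (p) => //= q ->; rewrite linearZ.
  rewrite iterZ; congr (_ *: _).
  have -> : (m ^+ 2)%:C = (`|z|%N%:~R / 2) ^+ 2 :> K.
    have z2 : z ^+ 2 = (`|z|%N : int) ^+ 2 by rewrite abszE real_normK ?num_real.
    rewrite rmorphXn /= half_intC !expr_div_n; congr (_ / _).
    by rewrite -rmorphXn z2 rmorphXn.
  rewrite natrM natrD -mul2n PoszD PoszM intrD intrM.
  by rewrite -[`|z|%N%:~R]/(`|z|%N%:R) -[r%:~R]/(r%:R); field.
- move=> n n0; rewrite (virasoro_iterF he_sum_null) (vacuum_virasoro vac) //.
  by elim: (p) => //= q ->; rewrite linear0.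
Qed.

Lemma goldstone_primary g : goldstone V m g ->
  g != 0 /\ exists N : nat, primary m N g.
Proof.
move=> /goldstone_half [r [p [xi [rp vac xi0 ->]]]].
by have [g0 pg] := iterF_primary rp vac xi0; split=> //; exists (r * (`|z| + r))%N.
Qed.

Lemma primary_singular N g : primary m N g -> g != 0 -> singular V g.
Proof. by case=> _ L0 Lpos g0; split=> //; eexists; exact: L0. Qed.

End Goldstone.

Section Singular.
Local Open Scope complex_scope.
Variables (R : realType) (V : level_one_rep R).

Lemma singular_half_weight (z : int) (v : V) : singular V v ->
  weight_space V (z%:~R / 2) v ->
  exists r p : nat, (`|z| + r.*2)%N%:Z = z + 2 * p%:Z /\
    primary (z%:~R / 2) (r * (`|z| + r)) v.
Proof.
move=> [v0 [l L0] Lpos] wt; have [n vn] := energy_below_exists v.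
have [d lE] := singular_energy_square v0 wt L0 Lpos vn.
have [w wE] : exists w : int, w = 2 * d%:Z - z by exists (2 * d%:Z - z).
have lw : l = ((w%:~R / 2) ^+ 2)%:C.
  by rewrite lE rmorphXn /= !half_intC wE intrB intrM; congr (_ ^+ 2); field.
(* [w / 2] is d - m, whose square is [l], so positivity compares absolute values. As [w] and [z]
   have the same parity, the differences halve to [r] and [p]. *)
have zw : (`|z| <= `|w|)%N.
  have := virasoro0_ge wt L0 v0; rewrite lw lecR !expr_div_n ler_pM2r ?invr_gt0 ?exprn_gt0 //.
  rewrite -!rmorphXn /= ler_int -[z ^+ 2]real_normK ?num_real // -[w ^+ 2]real_normK ?num_real //.
  by rewrite ler_pXn2r ?nnegrE //; lia.
have [r rE] : exists r : nat, `|w|%N = (`|z| + r.*2)%N.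
  by exists ((absz w - absz z) %/ 2)%N; lia.
have [p pE] : exists p : nat, (`|z| + r.*2)%N%:Z = z + 2 * p%:Z.
  by exists ((absz ((absz w)%:Z - z)%R) %/ 2)%N; lia.
exists r, p; split=> //; split=> //; rewrite L0; congr (_ *: _).
have w2 : w ^+ 2 = (`|z| + r.*2)%N%:Z ^+ 2 by rewrite -rE abszE real_normK ?num_real.
have z2 : z ^+ 2 = (`|z|%N : int) ^+ 2 by rewrite abszE real_normK ?num_real.
rewrite lw !rmorphXn /= !half_intC !expr_div_n -!rmorphXn w2 z2 !rmorphXn /=.
rewrite natrM natrD -mul2n PoszD PoszM intrD intrM.
by rewrite -[`|z|%N%:~R]/(`|z|%N%:R) -[r%:~R]/(r%:R); field.
Qed.

End Singular.

Theorem theoremB (R : realType) (j m : R)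
    (hj : j = 0 \/ j = 2^-1)
    (hm : exists a : int, m = j + a%:~R)
    (V : level_one_rep R)
    (hV : irreducible_rep V)
    (hV0 : lowest_energy_spin V j)
    (v : V) (hv : weight_space V m v) :
  singular V v <->
  exists (c : R[i]) (g : V), [/\ c != 0, goldstone V m g & v = c *: g].
Proof.
have [a [ja line]] := vacuum_line hV hj hV0.
case: hm => b mb; pose z := a + 2 * b.
have mE : m = z%:~R / 2 by rewrite mb ja /z intrD intrM; field.
rewrite {mb}mE in hv *; split=> [sv|[c [g [c0 gg ->]]]].
  have [r [p [rp pv]]] := singular_half_weight sv hv.
  have [i iE] : exists i : int, a + 2 * i = (`|z| + r.*2)%N.
    by exists (b + p%:Z); rewrite rp /z; lia.
  have [x [x0 vac _]] := line i; rewrite iE in vac.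
  have [g0 pg] := iterF_primary hV hj hV0 rp vac x0.
  (* Both vectors have weight m and energy k^2. Uniqueness is tested on the vacuum line of weight m
     (index [b]), not on that of xi_k (index [i]). *)
  have [|c vE] := primary_unique _ pg g0 pv.
    have [xb [xb0 _ one]] := line b.
    move=> y y'; rewrite half_intC => /one [c1 ->] cx /one [c2 ->].
    exists (c2 / c1); rewrite scalerA divfK //.
    by apply: contraNneq cx => ->; rewrite scale0r.
  exists c, (iter p (pe_mode V (sl2F R) 0) x); split=> //.
    by have [v0 _ _] := sv; apply: contraNneq v0 => c0; rewrite vE c0 scale0r.
  exists ((`|z| + r.*2)%N%:R / 2), r, p, x; split=> //.
  - have -> : `|z%:~R / 2 : R| = `|z|%N%:R / 2.
      by rewrite normrM -intr_norm normfV (ger0_norm (_ : 0 <= 2)) // -abszE.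
    by rewrite natrD -mul2n natrM; field.
  - by rewrite [X in X / 2]pmulrn rp intrD intrM -[p%:~R]/(p%:R); field.
  - by have [xw xpos] := vac; split=> //; rewrite fmorph_div !rmorph_nat.
have [g0 [N pg]] := goldstone_primary hV hj hV0 gg.
apply: (primary_singular (primaryZ c pg)).
by rewrite scaler_eq0 negb_or c0.
Qed.
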